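(* Let $\lambda,\mu\in\mathbb{R}$ and suppose that $H_{\lambda\mu}(0)$ has $n$ eigenvalues (counted with multiplicity) below (resp. above) its essential spectrum. Then for each $K\in\mathbb{T}^2$ the operator $H_{\lambda\mu}(K)$ has at least $n$ eigenvalues (counted with multiplicity) below (resp. above) its essential spectrum.
   Context: Let $\mathbb{T}^2=(\mathbb{R}/2\pi\mathbb{Z})^2\equiv[-\pi,\pi)^2$ and let $L^{2,o}(\mathbb{T}^2)$ be the Hilbert space of square-integrable odd functions on $\mathbb{T}^2$ (i.e. $f(-p)=-f(p)$). For $K=(K_1,K_2)\in\mathbb{T}^2$ (with representatives $K_i\in[-\pi,\pi)$) let $\mathcal{E}_K(p)=2\sum_{i=1}^2\bigl(1-\cos\tfrac{K_i}{2}\cos p_i\bigr)$ and let $H_0(K)$ be multiplication by $\mathcal{E}_K$ on $L^{2,o}(\mathbb{T}^2)$. For $\lambda,\mu\in\mathbb{R}$ let $V_{\lambda\mu}$ be the finite-rank self-adjoint operator on $L^{2,o}(\mathbb{T}^2)$ $$[V_{\lambda\mu}f](s)=\frac{\lambda}{(2\pi)^2}\sum_{i=1}^2\sin s_i\int_{\mathbb{T}^2}\sin t_i\, f(t)\,dt+\frac{\mu}{(2\pi)^2}\sum_{i=1}^2\sin 2s_i\int_{\mathbb{T}^2}\sin 2t_i\, f(t)\,dt+\frac{\mu}{2\pi^2}\sum_{i=1}^2\sum_{j\neq i}\sin s_i\cos s_j\int_{\mathbb{T}^2}\sin t_i\cos t_j\, f(t)\,dt,$$ where in the last double sum $i,j\in\{1,2\}$.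 Set $H_{\lambda\mu}(K)=H_0(K)+V_{\lambda\mu}$. Its essential spectrum is $[\mathcal{E}_{\min}(K),\mathcal{E}_{\max}(K)]$ with $\mathcal{E}_{\min}(K)=2\sum_{i=1}^2(1-\cos\tfrac{K_i}{2})$ and $\mathcal{E}_{\max}(K)=2\sum_{i=1}^2(1+\cos\tfrac{K_i}{2})$. *)

(* Defs.v *)
From HB Require Import structures.
From mathcomp Require Import all_boot all_order all_algebra.
From mathcomp Require Import all_classical all_reals all_analysis.
From mathcomp Require Import complex.

Set Implicit Arguments.
Unset Strict Implicit.
Unset Printing Implicit Defensive.

Import Order.TTheory GRing.Theory Num.Theory.
Import numFieldNormedType.Exports.

Local Open Scope classical_set_scope.
Local Open Scope ring_scope.
Local Open Scope complex_scope.

Section Torus.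
Variable R : realType.

Local Notation mR := (measurableTypeR R).

(* The torus (R / 2 pi Z)^2 is represented by its fundamental domain
   [-pi, pi)^2. Functions on it are functions on R * R of which only the values
   on [torus], up to null sets, are relevant. [measurableTypeR R] is R with the
   Borel sigma-algebra that carries [lebesgue_measure]. *)
Definition torus : set (mR * mR) := `[- pi, pi[ `*` `[- pi, pi[.

Definition leb2 : set (mR * mR) -> \bar R :=
  ((@lebesgue_measure R) \x (@lebesgue_measure R))%E.
HB.instance Definition _ := Measure.on leb2.

Definition ae_torus (P : mR * mR -> Prop) : Prop :=
  {ae leb2, forall p : mR * mR, torus p -> P p}.

Definition tcoord (p : R * R) (i : 'I_2) : R := if i == ord0 then p.1 else p.2.

Local Notation fct := (R * R -> R[i]).

Definition sqnormc (z : R[i]) : R := complex.Re z ^+ 2 + complex.Im z ^+ 2.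

Definition cintegral (f : fct) : R[i] :=
  (\int[leb2]_(p in torus) complex.Re (f p))%R
  +i* (\int[leb2]_(p in torus) complex.Im (f p))%R.

(* Elements of L^{2,o} are the functions satisfying [L2odd], identified when
   they agree almost everywhere on the torus. Oddness is required almost
   everywhere; the points of [torus] whose opposite is not in [torus] form a
   null set, so no reduction modulo 2 pi is needed. *)
Definition L2odd (f : fct) : Prop :=
  [/\ measurable_fun torus (fun p : mR * mR => complex.Re (f p)),
      measurable_fun torus (fun p : mR * mR => complex.Im (f p)),
      (\int[leb2]_(p in torus) (sqnormc (f p))%:E < +oo)%E &
      ae_torus (fun p => f (- p) = - f p)].

Definition inner (f g : fct) : R[i] := cintegral (fun p => f p * (g p)^*).

Definition L2norm (f : fct) : R :=
  Num.sqrt (\int[leb2]_(p in torus) sqnormc (f p))%R.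

End Torus.

Section Spectrum.
Variable R : realType.

Local Notation fct := (R * R -> R[i]).

(* A is meant to be a bounded self-adjoint operator on L^{2,o}, given by its
   action on representatives. Its spectrum is real, so only real spectral
   parameters are considered. *)
Implicit Type A : fct -> fct.

Definition in_eigenspace A (x : R) (f : fct) : Prop :=
  L2odd f /\ ae_torus (fun p => A f p = x%:C * f p).

Definition lin_indep (k : nat) (f : 'I_k -> fct) : Prop :=
  forall c : 'I_k -> R[i],
    ae_torus (fun p => \sum_(j < k) c j * f j p = 0) -> forall j, c j = 0.

(* The dimension of the eigenspace of x; it is 0 if x is not an eigenvalue. *)
Definition multiplicity A (x : R) : \bar R :=
  ereal_sup [set k%:R%:E | k in [set k : nat |
    exists f : 'I_k -> fct, lin_indep f /\ forall j, in_eigenspace A x (f j)]].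

(* Singular Weyl sequences: normalized, weakly null approximate eigenvectors. *)
Definition ess_spectrum A : set R := [set x |
  exists u : nat -> fct,
    [/\ forall m, L2odd (u m),
        forall m, L2norm (u m) = 1,
        forall g, L2odd g ->
          (fun m => Num.sqrt (sqnormc (inner (u m) g))) @ \oo --> (0 : R) &
        (fun m => L2norm (fun p => A (u m) p - x%:C * u m p)) @ \oo --> (0 : R)]].

Definition num_eigen_below A : \bar R :=
  \esum_(x in [set x | forall y, ess_spectrum A y -> x < y]) multiplicity A x.

Definition num_eigen_above A : \bar R :=
  \esum_(x in [set x | forall y, ess_spectrum A y -> y < x]) multiplicity A x.

End Spectrum.

Section Hamiltonian.
Variable R : realType.

Local Notation fct := (R * R -> R[i]).

Definition dispersion (K p : R * R) : R :=
  2 * \sum_(i < 2) (1 - cos (tcoord K i / 2) * cos (tcoord p i)).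

Definition free_hamiltonian (K : R * R) (f : fct) : fct :=
  fun p => (dispersion K p)%:C * f p.

Definition interaction (lambda mu : R) (f : fct) : fct := fun s =>
  (lambda / (2 * pi) ^+ 2)%:C *
    (\sum_(i < 2) (sin (tcoord s i))%:C *
       cintegral (fun t => (sin (tcoord t i))%:C * f t))
  + (mu / (2 * pi) ^+ 2)%:C *
    (\sum_(i < 2) (sin (2 * tcoord s i))%:C *
       cintegral (fun t => (sin (2 * tcoord t i))%:C * f t))
  + (mu / (2 * pi ^+ 2))%:C *
    (\sum_(i < 2) \sum_(j < 2 | j != i)
       (sin (tcoord s i) * cos (tcoord s j))%:C *
       cintegral (fun t => (sin (tcoord t i) * cos (tcoord t j))%:C * f t)).

Definition hamiltonian (lambda mu : R) (K : R * R) (f : fct) : fct :=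
  fun p => free_hamiltonian K f p + interaction lambda mu f p.

End Hamiltonian.

(* Main.v *)
(* Only real odd functions are needed: an operator with real coefficients acts
   separately on real and imaginary parts. Since cos (K_i / 2) lies in [0, 1],
     E_K - E_min(K) = 2 sum_i cos (K_i / 2) (1 - cos p_i) <= E_0 - E_min(0),
   so the quadratic form of H(K) - E_min(K) is below that of H(0) - E_min(0) and
   is negative on the span of the given n eigenfunctions of H(0). As long as
   fewer than n orthonormal eigenfunctions of H(K) below E_min(K) are known, some
   function in this span is orthogonal to all of them, and the infimum e of the
   form of H(K) on their orthogonal complement is below E_min(K). It is attained:
   along a minimizing sequence f_m one has (H(K) - e) f_m -> 0, and after
   passing to a cluster point l of the finitely many coefficients <f_m, psi_k>,
   f_m is close in norm to the function
     u = - (E_K - e)^-1 sum_k v_k l_k psi_k,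
   which is the next eigenfunction. Eigenvalues above the essential spectrum are
   those of -H(K) below it. Weyl sequences locate the essential spectrum: it
   contains E_min(0) and E_max(0), and it lies in [E_min(K), E_max(K)]. *)
Require Import Defs.
From HB Require Import structures.
From mathcomp Require Import all_boot all_order all_algebra.
From mathcomp Require Import all_classical all_reals all_analysis.
From mathcomp Require Import measurable_realfun complex.
From mathcomp Require Import ring lra.

Set Implicit Arguments.
Unset Strict Implicit.
Unset Printing Implicit Defensive.

Import Order.TTheory GRing.Theory Num.Theory.
Import numFieldNormedType.Exports.

Local Open Scope classical_set_scope.
Local Open Scope ring_scope.

(** * Semi-inner products and finite-rank perturbations *)

(* Definiteness is not required, because functions that vanish almost everywhere
   are not identified with 0. *)
Record semi_inner (R : realType) (E : lmodType R) (ip : E -> E -> R) : Prop := SemiInner {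
  ipC : forall x y, ip x y = ip y x ;
  ipDl : forall x y z, ip (x + y) z = ip x z + ip y z ;
  ipZl : forall c x y, ip (c *: x) y = c * ip x y ;
  ip_ge0 : forall x, 0 <= ip x x }.

Section SemiInnerTheory.
Context (R : realType) (E : lmodType R) (ip : E -> E -> R).
Hypothesis ipP : semi_inner ip.

Lemma ipDr x y z : ip z (x + y) = ip z x + ip z y.
Proof. by rewrite !(ipC ipP z) (ipDl ipP). Qed.

Lemma ipZr c x y : ip y (c *: x) = c * ip y x.
Proof. by rewrite !(ipC ipP y) (ipZl ipP). Qed.

Lemma ip0l x : ip 0 x = 0.
Proof. by rewrite -(scale0r 0) (ipZl ipP) mul0r. Qed.

Lemma ipNl x y : ip (- x) y = - ip x y.
Proof. by rewrite -scaleN1r (ipZl ipP) mulN1r. Qed.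

Lemma ipNr x y : ip x (- y) = - ip x y.
Proof. by rewrite -scaleN1r ipZr mulN1r. Qed.

Lemma ipBl x y z : ip (x - y) z = ip x z - ip y z.
Proof. by rewrite (ipDl ipP) ipNl. Qed.

Lemma ipBr x y z : ip z (x - y) = ip z x - ip z y.
Proof. by rewrite ipDr ipNr. Qed.

Lemma ip_suml (I : Type) (r : seq I) (P : pred I) (F : I -> E) y :
  ip (\sum_(i <- r | P i) F i) y = \sum_(i <- r | P i) ip (F i) y.
Proof.
apply: (big_morph (fun x => ip x y)) => [u v|]; first exact: ipDl.
exact: ip0l.
Qed.

Lemma ip_sumr (I : Type) (r : seq I) (P : pred I) (F : I -> E) y :
  ip y (\sum_(i <- r | P i) F i) = \sum_(i <- r | P i) ip y (F i).
Proof. by rewrite (ipC ipP) ip_suml; apply: eq_bigr => i _; exact: ipC. Qed.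

Lemma ip_sqrB x y : ip (x - y) (x - y) = ip x x - 2 * ip x y + ip y y.
Proof. by rewrite !(ipBl, ipBr) (ipC ipP y x); ring. Qed.

Lemma ip_sqrD_le x y : ip (x + y) (x + y) <= 2 * ip x x + 2 * ip y y.
Proof.
have := ip_ge0 ipP (x - y).
rewrite ip_sqrB !(ipDl ipP) !ipDr (ipC ipP y x) => h; lra.
Qed.

Lemma ip_sqrB_le x y : ip (x - y) (x - y) <= 2 * ip x x + 2 * ip y y.
Proof. by have := ip_sqrD_le x (- y); rewrite ipNl ipNr opprK. Qed.

(** The form is nonnegative at [x - t *: y] for every [t]. A nonzero [y] may satisfy [ip y y = 0];
    the quadratic is then affine in [t], which forces [ip x y = 0]. *)
Lemma ip_cauchy_schwarz x y : ip x y ^+ 2 <= ip x x * ip y y.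
Proof.
have hx := ip_ge0 ipP x; have hy := ip_ge0 ipP y.
have key t : 0 <= ip x x - 2 * t * ip x y + t ^+ 2 * ip y y.
  have := ip_ge0 ipP (x - t *: y); rewrite ip_sqrB (ipZl ipP) !ipZr.
  by have -> : ip x x - 2 * (t * ip x y) + t * (t * ip y y) =
     ip x x - 2 * t * ip x y + t ^+ 2 * ip y y by ring.
have [y0|yn0] := eqVneq (ip y y) 0.
  rewrite y0 mulr0; have [->|xy0] := eqVneq (ip x y) 0; first by rewrite expr0n.
  (* This [t] makes the affine expression equal to [-1]. *)
  have := key ((ip x x + 1) / (2 * ip x y)); rewrite y0 mulr0 addr0.
  have -> : 2 * ((ip x x + 1) / (2 * ip x y)) * ip x y = ip x x + 1 by field.
  lra.
have y0 : 0 < ip y y by rewrite lt0r yn0.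
have := key (ip x y / ip y y).
have -> : ip x x - 2 * (ip x y / ip y y) * ip x y + (ip x y / ip y y) ^+ 2 * ip y y
   = (ip x x * ip y y - ip x y ^+ 2) / ip y y by field.
by rewrite pmulr_lge0 ?invr_gt0// subr_ge0.
Qed.

(** The [psi k] are not assumed orthogonal, hence the double sum; what matters is that this factor
    does not depend on [d]. *)
Lemma ip_combination_le N (v d : 'I_N -> R) (psi : 'I_N -> E) s :
  (forall k, `|d k| <= s) ->
  ip (\sum_(k < N) (v k * d k) *: psi k) (\sum_(k < N) (v k * d k) *: psi k)
  <= s ^+ 2 * \sum_(i < N) \sum_(j < N) `|v i * v j * ip (psi i) (psi j)|.
Proof.
move=> ds; rewrite ip_suml mulr_sumr ler_sum// => i _.
rewrite ip_sumr mulr_sumr ler_sum// => j _.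
rewrite (ipZl ipP) ipZr.
have -> : v i * d i * (v j * d j * ip (psi i) (psi j)) =
   d i * d j * (v i * v j * ip (psi i) (psi j)) by ring.
apply: le_trans (ler_norm _) _; rewrite normrM ler_wpM2r// normrM expr2.
by rewrite ler_pM.
Qed.

End SemiInnerTheory.

(** * Cluster points and arbitrarily small bounds *)

(** Compactness of the cube [[-B, B]^N]. In place of a subsequence, there are indices beyond every
    [M] at which all coordinates are close at once. *)
Lemma bounded_coordinates_cluster (R : realType) (N : nat) (B : R)
    (c : nat -> 'I_N -> R) :
  (forall m k, `|c m k| <= B) ->
  exists l : 'I_N -> R, forall e, 0 < e -> forall M, exists m,
    (M <= m)%N /\ forall k, `|c m k - l k| < e.
Proof.
move=> cB.
have K : compact [set v : 'rV[R]_N | forall i, `[- B, B]%classic (v ord0 i)].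
  by apply: (@rV_compact _ _ (fun=> `[- B, B]%classic)) => _; exact: segment_compact.
have := K ((fun m => \row_k c m k) @ \oo) _ _.
case=> [|v [vB vcl]].
  exists 0%N => // m _ /= i; rewrite mxE in_itv /=.
  by have := cB m i; rewrite ler_norml.
exists (fun k => v ord0 k) => e e0 M.
have [||w [[m Mm <-] hw]] := vcl [set \row_k c m k | m in [set m | (M <= m)%N]] (ball v e).
- by exists M => // m /= Mm; exists m.
- exact: nbhsx_ballx.
exists m; split => // k.
have [_ /(_ ord0 k)] := hw; rewrite mxE /ball /= distrC; apply.
Qed.

Lemma invn_eventually_le (R : realType) (x : R) : 0 < x ->
  exists M, forall m, (M <= m)%N -> m.+1%:R^-1 <= x.
Proof.
move=> x0; exists (Num.truncn x^-1) => m Mm.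
rewrite invf_ple ?posrE//; apply: le_trans (ltW (truncnS_gt _)) _.
by rewrite ler_nat ltnS.
Qed.

(** Turns approximations of arbitrary quality into equalities. Taking [e = 1] shows [0 <= C]; for
    [x != 0] the value [x ^+ 2 / (C + 1) / 2] of [e] then contradicts the hypothesis. *)
Lemma eq0_of_sqr_le_eps (R : realType) (x C : R) :
  (forall e, 0 < e -> x ^+ 2 <= e * C) -> x = 0.
Proof.
move=> h; have C0 : 0 <= C by have := h 1 ltr01; have := sqr_ge0 x; lra.
apply/eqP; rewrite -sqrf_eq0 eq_le sqr_ge0 andbT leNgt; apply/negP => x0.
have /h : 0 < x ^+ 2 / (C + 1) / 2 by rewrite !divr_gt0//; lra.
have -> : x ^+ 2 / (C + 1) / 2 * C = x ^+ 2 * (C / (C + 1) / 2) by ring.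
rewrite ler_pMr// => h1.
have : C / (C + 1) / 2 < 1 by rewrite !ltr_pdivrMr; lra.
lra.
Qed.

(** * Finite-rank perturbations of a semibounded operator and attainment of the infimum *)

Definition finite_rank (R : realType) (E : lmodType R) (ip : E -> E -> R)
    (N : nat) (v : 'I_N -> R) (psi : 'I_N -> E) (f : E) : E :=
  \sum_(k < N) (v k * ip f (psi k)) *: psi k.

Definition ham (R : realType) (E : lmodType R) (ip : E -> E -> R)
    (N : nat) (v : 'I_N -> R) (psi : 'I_N -> E) (D : E -> E) (f : E) : E :=
  D f + finite_rank ip v psi f.

(** Abstracts multiplication by a bounded real function. The solvability condition [sb_res] stands
    in for completeness: the eigenvector in [exists_eigenvector] is obtained from it. *)
Record semibounded (R : realType) (E : lmodType R) (ip : E -> E -> R)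
    (D : E -> E) (a : R) : Prop := Semibounded {
  sbD : forall f g, D (f + g) = D f + D g ;
  sbZ : forall c f, D (c *: f) = c *: D f ;
  sb_sym : forall f g, ip (D f) g = ip f (D g) ;
  sb_lb : forall f, a * ip f f <= ip (D f) f ;
  sb_ub : exists b, forall f, ip (D f) f <= b * ip f f ;
  sb_res : forall e, e < a -> forall h, exists g, D g - e *: g = h }.

Section Variational.
Context (R : realType) (E : lmodType R) (ip : E -> E -> R).
Hypothesis ipP : semi_inner ip.
Context (N : nat) (v : 'I_N -> R) (psi : 'I_N -> E) (D : E -> E) (a : R).
Hypothesis DP : semibounded ip D a.

Local Notation V := (finite_rank ip v psi).
Local Notation H := (ham ip v psi D).

Lemma finite_rankD f g : V (f + g) = V f + V g.
Proof.
rewrite /finite_rank -big_split/=; apply: eq_bigr => k _.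
by rewrite (ipDl ipP) mulrDr scalerDl.
Qed.

Lemma finite_rankZ c f : V (c *: f) = c *: V f.
Proof.
rewrite /finite_rank scaler_sumr; apply: eq_bigr => k _.
by rewrite (ipZl ipP) scalerA; congr (_ *: _); ring.
Qed.

Lemma ip_finite_rank f g : ip (V f) g = \sum_(k < N) v k * ip f (psi k) * ip g (psi k).
Proof.
rewrite /finite_rank (ip_suml ipP); apply: eq_bigr => k _.
by rewrite (ipZl ipP) (ipC ipP g).
Qed.

Lemma finite_rank_sym f g : ip (V f) g = ip f (V g).
Proof.
rewrite (ipC ipP f) !ip_finite_rank; apply: eq_bigr => k _; ring.
Qed.

Let M := \sum_(k < N) `|v k| * ip (psi k) (psi k).

Lemma finite_rank_bound f : `|ip (V f) f| <= M * ip f f.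
Proof.
rewrite ip_finite_rank mulr_suml; apply: le_trans (ler_norm_sum _ _ _) _.
apply: ler_sum => k _; rewrite -mulrA -expr2 normrM -mulrA ler_wpM2l//.
rewrite ger0_norm ?sqr_ge0// mulrC; exact: ip_cauchy_schwarz.
Qed.

Lemma hamD f g : H (f + g) = H f + H g.
Proof. by rewrite /ham (sbD DP) finite_rankD addrACA. Qed.

Lemma hamZ c f : H (c *: f) = c *: H f.
Proof. by rewrite /ham (sbZ DP) finite_rankZ scalerDr. Qed.

Lemma ham_sym f g : ip (H f) g = ip f (H g).
Proof. by rewrite /ham (ipDl ipP) (ipDr ipP) (sb_sym DP) finite_rank_sym. Qed.

Lemma ham_lb f : (a - M) * ip f f <= ip (H f) f.
Proof.
rewrite /ham (ipDl ipP) mulrBl.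
have := sb_lb DP f; have := finite_rank_bound f; rewrite ler_norml => /andP[]; lra.
Qed.

Lemma ham_ub : exists b, forall f, ip (H f) f <= b * ip f f.
Proof.
have [b hb] := sb_ub DP; exists (b + M) => f; rewrite /ham (ipDl ipP) mulrDl.
by have := hb f; have := finite_rank_bound f; rewrite ler_norml => /andP[]; lra.
Qed.

(** With [g = D f - e *: f], expand the square of [g - (a - e) *: f] and use
    [(a - e) * ip f f <= ip g f]. Small residuals of [D - e] thus come from small vectors. *)
Lemma coercive_bound (e : R) f : e < a ->
  (a - e) ^+ 2 * ip f f <= ip (D f - e *: f) (D f - e *: f).
Proof.
move=> ea; set g := D f - e *: f.
have h : (a - e) * ip f f <= ip g f.
  by rewrite /g (ipBl ipP) (ipZl ipP) mulrBl; have := sb_lb DP f; lra.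
have := ip_ge0 ipP (g - (a - e) *: f).
rewrite (ip_sqrB ipP) (ipZr ipP) (ipZl ipP) (ipZr ipP).
have : (a - e) * ((a - e) * ip f f) <= (a - e) * ip g f by rewrite ler_wpM2l// subr_ge0 ltW.
by rewrite expr2 -mulrA; lra.
Qed.

(* Test the nonnegative form at [f - C^-1 (H f - e f)]. *)
Lemma sqr_residual_le (S : E -> Prop) (e : R) :
  (forall f, S f -> S (H f)) -> (forall f g, S f -> S g -> S (f - g)) ->
  (forall c f, S f -> S (c *: f)) ->
  (forall f, S f -> e * ip f f <= ip (H f) f) ->
  exists C, 0 < C /\ forall f, S f ->
    ip (H f - e *: f) (H f - e *: f) <= C * (ip (H f) f - e * ip f f).
Proof.
move=> SH SB SZ Se; have [b hb] := ham_ub.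
(* An upper bound for the form of [H - e]; the summand 1 makes it positive. *)
pose C := `|b| + `|e| + 1.
have C0 : 0 < C by rewrite /C ltr_wpDl// addr_ge0.
exists C; split => // f Sf; set g := H f - e *: f.
have Sg : S g by apply: SB; [exact: SH|exact: SZ].
have qg : ip (H g) g - e * ip g g <= C * ip g g.
  rewrite /C !mulrDl mul1r; have := hb g; have := ip_ge0 ipP g.
  have : b * ip g g <= `|b| * ip g g by rewrite ler_wpM2r ?ip_ge0 ?ler_norm.
  have : - e * ip g g <= `|e| * ip g g.
    by rewrite ler_wpM2r ?ip_ge0// -normrN ler_norm.
  rewrite mulNr; lra.
suff : C^-1 * ip g g <= ip (H f) f - e * ip f f by rewrite ler_pdivrMl.
have gE : H f = g + e *: f by rewrite /g subrK.
clearbody g; have := Se _ (SB _ _ Sf (SZ C^-1 _ Sg)).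
have -> : H (f - C^-1 *: g) = H f - C^-1 *: H g.
  by rewrite hamD -scaleNr hamZ scaleNr.
rewrite (ip_sqrB ipP) (ipBl ipP) !(ipBr ipP) !(ipZl ipP) !(ipZr ipP) (ham_sym g f) (ipC ipP g).
have -> : ip (H f) g = ip g g + e * ip f g.
  by rewrite gE (ipDl ipP) (ipZl ipP).
move=> h.
(* With [q] the form of [H - e], the tested value is [q(f) - 2 C^-1 ip g g + C^-2 q(g)], and
   [q(g) <= C * ip g g] absorbs half of the middle term. *)
have : C^-1 * (C^-1 * (ip (H g) g - e * ip g g)) <= C^-1 * (C^-1 * (C * ip g g)).
  by rewrite !ler_wpM2l// invr_ge0 ltW.
rewrite (mulrA C^-1 C) mulVf ?gt_eqF// mul1r => h2.
lra.
Qed.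

(** One step of the variational construction. The trial vector [f0] puts the infimum [e] of the form
    below [a], where [D - e] is both coercive and solvable; the finite-rank part depends on only [N]
    coefficients, so convergence of these along suitable indices suffices. *)
Lemma exists_eigenvector (k : nat) (w : nat -> E) (ew : nat -> R) f0 :
  (forall j, (j < k)%N -> forall g, ip (H (w j)) g = ew j * ip (w j) g) ->
  (forall j, (j < k)%N -> ip f0 (w j) = 0) ->
  ip (H f0) f0 < a * ip f0 f0 ->
  exists u e, [/\ e < a, H u = e *: u, ip u u = 1 &
    forall j, (j < k)%N -> ip u (w j) = 0].
Proof.
move=> Hw f0w f0a.
(* The orthogonal complement of the [w j]; it is invariant under [H] by symmetry. *)
pose S f := forall j, (j < k)%N -> ip f (w j) = 0.
have SH f : S f -> S (H f).
  by move=> Sf j jk; rewrite ham_sym (ipC ipP) Hw// (ipC ipP) Sf// mulr0.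
have SB f g : S f -> S g -> S (f - g).
  by move=> Sf Sg j jk; rewrite (ipBl ipP) Sf// Sg// subrr.
have SZ c f : S f -> S (c *: f) by move=> Sf j jk; rewrite (ipZl ipP) Sf// mulr0.
have normalized f : 0 < ip f f -> S f ->
    exists t, [/\ S (t *: f), ip (t *: f) (t *: f) = 1 &
       ip (H (t *: f)) (t *: f) = ip (H f) f / ip f f].
  move=> f_gt0 Sf; exists (Num.sqrt (ip f f))^-1.
  have tt : (Num.sqrt (ip f f))^-1 * (Num.sqrt (ip f f))^-1 = (ip f f)^-1.
    by rewrite -invfM -expr2 sqr_sqrtr// ltW.
  split; first exact: SZ.
    by rewrite (ipZl ipP) (ipZr ipP) mulrA tt mulVf// gt_eqF.
  by rewrite hamZ (ipZl ipP) (ipZr ipP) mulrA tt mulrC.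
pose Q := [set r | exists f, [/\ S f, ip f f = 1 & r = ip (H f) f]].
have Qlb : lbound Q (a - M).
  by move=> _ [f [_ f1 ->]]; have := ham_lb f; rewrite f1 mulr1.
(* On null vectors [ham_lb] makes the form nonnegative, which the strict inequality for [f0]
   excludes. *)
have f0_gt0 : 0 < ip f0 f0.
  rewrite lt0r (ip_ge0 ipP) andbT; apply/eqP => z.
  by have := ham_lb f0; move: f0a; rewrite z !mulr0; lra.
have Q0 : Q (ip (H f0) f0 / ip f0 f0).
  have [t [St t1 tE]] := normalized _ f0_gt0 f0w.
  by exists (t *: f0).
have Qinf : has_inf Q by split; [exists (ip (H f0) f0 / ip f0 f0)|exists (a - M)].
pose e := inf Q.
have ea : e < a.
  apply: (@le_lt_trans _ _ (ip (H f0) f0 / ip f0 f0)).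
    by apply: ge_inf => //; exists (a - M).
  by rewrite ltr_pdivrMr.
have Se f : S f -> e * ip f f <= ip (H f) f.
  move=> Sf; have := ip_ge0 ipP f; rewrite le_eqVlt => /predU1P[z|f_gt0].
    by have := ham_lb f; rewrite -z !mulr0.
  rewrite -ler_pdivlMr//; apply: ge_inf; first by exists (a - M).
  by have [t [St t1 tE]] := normalized _ f_gt0 Sf; exists (t *: f).
have [C [C0 hC]] := sqr_residual_le SH SB SZ Se.
have /choice[F hF] (m : nat) : exists f, [/\ S f, ip f f = 1 &
    ip (H f) f < e + m.+1%:R^-1].
  have m0 : 0 < m.+1%:R^-1 :> R by rewrite invr_gt0.
  by have [_ [f [Sf f1 ->]] lt] := inf_adherent m0 Qinf; exists f.
(* The bound comes from [2 t <= 1 + t^2] with [t] the modulus of a coefficient, and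
   Cauchy-Schwarz. *)
pose B := 1 + \sum_(i < N) ip (psi i) (psi i).
have cB m i : `|ip (F m) (psi i)| <= B.
  have [_ F1 _] := hF m.
  have := ip_cauchy_schwarz ipP (F m) (psi i); rewrite F1 mul1r => h.
  have h2 : ip (psi i) (psi i) <= \sum_(i < N) ip (psi i) (psi i).
    by rewrite (bigD1 i)//= lerDl sumr_ge0// => j _; exact: ip_ge0.
  have := sqr_ge0 (`|ip (F m) (psi i)| - 1).
  rewrite sqrrB1 -normrX ger0_norm ?sqr_ge0 // /B => h3.
  have := normr_ge0 (ip (F m) (psi i)).
  by rewrite -mulr_natl in h3; lra.
(* The minimizing sequence clusters in norm at the solution [u] of
   [(D - e) u = - sum_i v_i l_i psi_i], hence no weak compactness is needed. *)
have [l hl] := bounded_coordinates_cluster cB.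
have [u hu] := sb_res DP ea (- \sum_(i < N) (v i * l i) *: psi i).
pose G := \sum_(i < N) \sum_(j < N) `|v i * v j * ip (psi i) (psi j)|.
have G0 : 0 <= G by apply: sumr_ge0 => i _; apply: sumr_ge0.
pose d2 := (a - e) ^+ 2.
have d20 : 0 < d2 by rewrite exprn_gt0// subr_gt0.
(* [C] controls the residual of the minimizing vector and [G] the error in its coefficients; the
   factors 2 come from the square of a difference, [d2] from coercivity. *)
pose Z := (2 * C + 2 * G) / d2.
have Z0 : 0 <= Z.
  by rewrite /Z divr_ge0 ?(ltW d20)// addr_ge0// mulr_ge0// ltW.
have approx eta : 0 < eta -> exists f, [/\ S f, ip f f = 1,
    ip (f - u) (f - u) <= eta * Z & forall i, (ip f (psi i) - l i) ^+ 2 <= eta].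
  (* Having [eps <= 1] allows [eps ^+ 2] to be replaced by [eps]. *)
  move=> eta0; pose eps := Num.min eta 1.
  have eps0 : 0 < eps by rewrite lt_min eta0/=.
  have eps1 : eps <= 1 by rewrite ge_min lexx orbT.
  have eps_eta : eps <= eta by rewrite ge_min lexx.
  have [M0 hM0] := invn_eventually_le eps0.
  have [m [Mm hm]] := hl _ eps0 M0.
  have [SF F1 Fe] := hF m.
  exists (F m); split => // [|i]; last first.
    apply: le_trans eps_eta; rewrite -(real_normK (num_real _)) expr2 -[leRHS]mulr1.
    by rewrite ler_pM// ?(ltW (hm i))//; apply: le_trans eps1; exact: ltW.
  set f := F m in SF F1 Fe hm *.
  apply: (@le_trans _ _ (eps * Z)); last by rewrite ler_wpM2r.
  rewrite /Z mulrA ler_pdivlMr// mulrC.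
  apply: le_trans (coercive_bound _ ea) _.
  pose y := \sum_(i < N) (v i * (ip f (psi i) - l i)) *: psi i.
  (* The equation for [u] replaces the coefficients of [f] by their cluster values, so that only the
     residual of [f] and the coefficient errors [y] remain. *)
  have -> : D (f - u) - e *: (f - u) = (H f - e *: f) - y.
    have -> : D (f - u) - e *: (f - u) = (D f - e *: f) - (D u - e *: u).
      have -> : D (f - u) = D f - D u.
        by rewrite (sbD DP) -scaleN1r (sbZ DP) scaleN1r.
      by rewrite scalerBr !opprD !opprK addrACA.
    rewrite hu opprK.
    have -> : y = V f - \sum_(i < N) (v i * l i) *: psi i.
      rewrite /y /finite_rank -sumrB; apply: eq_bigr => i _.
      by rewrite mulrBr scalerBl.
    rewrite opprB /ham [in RHS](addrAC (D f)) -!addrA; congr (_ + (_ + _)).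
    by rewrite addrCA subrr addr0.
  apply: le_trans (ip_sqrB_le ipP _ _) _.
  rewrite mulrDr; apply: lerD.
    rewrite mulrCA ler_pM2l//; apply: le_trans (hC _ SF) _.
    rewrite (mulrC eps) ler_pM2l// F1 mulr1; rewrite lerBlDl.
    by apply: le_trans (ltW Fe) _; rewrite lerD2l hM0.
  rewrite mulrCA ler_pM2l//.
  apply: le_trans (ip_combination_le ipP v psi (fun i => ltW (hm i))) _.
  by rewrite -/G ler_wpM2r// expr2 ler_piMl// ltW.
(* Once [u] has the coefficients [l i], its defining equation reads [H u = e *: u]. *)
clearbody Z; have ul i : ip u (psi i) = l i.
  apply/eqP; rewrite -subr_eq0; apply/eqP.
  apply: (@eq0_of_sqr_le_eps _ _ (2 * Z * ip (psi i) (psi i) + 2)) => eta eta0.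
  have [f [_ _ h1 h2]] := approx _ eta0.
  have -> : ip u (psi i) - l i = (ip f (psi i) - l i) - ip (f - u) (psi i).
    by rewrite (ipBl ipP); ring.
  have h3 := ip_cauchy_schwarz ipP (f - u) (psi i).
  have h4 := ler_wpM2r (ip_ge0 ipP (psi i)) h1.
  have := sqr_ge0 ((ip f (psi i) - l i) + ip (f - u) (psi i)).
  by have := h2 i; move: h3 h4; rewrite sqrrB sqrrD; lra.
exists u, e; split => //.
- apply/eqP; rewrite -subr_eq0 /ham addrAC hu /finite_rank.
  by under [X in _ + X]eq_bigr do rewrite ul; rewrite addNr.
- apply/esym/eqP; rewrite -subr_eq0; apply/eqP.
  apply: (@eq0_of_sqr_le_eps _ _ (Z * (2 + 2 * ip u u))) => eta eta0.
  have [f [_ f1 h1 _]] := approx _ eta0.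
  have -> : 1 - ip u u = ip (f - u) (f + u).
    by rewrite (ipBl ipP) !(ipDr ipP) f1 (ipC ipP u f); ring.
  apply: le_trans (ip_cauchy_schwarz ipP _ _) _.
  rewrite mulrA ler_pM ?ip_ge0//.
  by have := ip_sqrD_le ipP f u; rewrite f1 mulr1.
- move=> j jk.
  apply: (@eq0_of_sqr_le_eps _ _ (Z * ip (w j) (w j))) => eta eta0.
  have [f [Sf _ h1 _]] := approx _ eta0.
  have -> : ip u (w j) ^+ 2 = ip (f - u) (w j) ^+ 2.
    by rewrite (ipBl ipP) Sf// sub0r sqrrN.
  apply: le_trans (ip_cauchy_schwarz ipP _ _) _.
  by rewrite mulrA ler_wpM2r ?ip_ge0.
Qed.

End Variational.

(** * Orthonormal systems of eigenvectors and the comparison of two operators *)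

(** The rank is at most [k], so the [n] rows are dependent. Serves to find combinations orthogonal
    to given vectors, over the reals and over the complex numbers. *)
Lemma left_kernel_nontrivial (F : fieldType) (n k : nat) (M : 'M[F]_(n, k)) :
  (k < n)%N -> exists2 c : 'rV[F]_n, c != 0 & c *m M = 0.
Proof.
move=> kn; exists (nz_row (kermx M)).
  rewrite nz_row_eq0 kermx_eq0 /row_free neq_ltn.
  by rewrite (leq_ltn_trans (rank_leq_col _) kn).
by apply/sub_kermxP; exact: nz_row_sub.
Qed.

Section EigenSystems.
Context (R : realType) (E : lmodType R) (ip : E -> E -> R).

(* The eigenvalue equation is tested against all vectors because [ip] may be
   degenerate: null vectors have to be disregarded. *)
Definition eigenvector (H : E -> E) (x : R) (f : E) : Prop :=
  forall g, ip (H f) g = x * ip f g.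

(** Families are indexed by [nat] and only the indices below [k] count, so that lengthening needs no
    casts. Repetitions among the [e j] account for multiplicities. *)
Definition orthonormal_eigensystem (H : E -> E) (S : set R) (k : nat)
    (u : nat -> E) (e : nat -> R) : Prop :=
  [/\ forall j, (j < k)%N -> S (e j),
      forall i j, (i < k)%N -> (j < k)%N -> ip (u i) (u j) = (i == j)%:R &
      forall j, (j < k)%N -> eigenvector H (e j) (u j)].

Definition has_eigensystem (H : E -> E) (S : set R) (k : nat) : Prop :=
  exists u e, orthonormal_eigensystem H S k u e.

Hypothesis ipP : semi_inner ip.

Lemma has_eigensystem_extend H S k u e x f :
  (forall c f, H (c *: f) = c *: H f) ->
  orthonormal_eigensystem H S k u e -> S x -> eigenvector H x f ->
  0 < ip f f -> (forall j, (j < k)%N -> ip f (u j) = 0) ->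
  has_eigensystem H S k.+1.
Proof.
move=> HZ [eS uu ue] Sx Hf f0 fu.
pose t := (Num.sqrt (ip f f))^-1.
have tt : t * t = (ip f f)^-1 by rewrite -invfM -expr2 sqr_sqrtr// ltW.
exists (fun i => if i == k then t *: f else u i), (fun i => if i == k then x else e i).
have ltk j : (j < k.+1)%N -> (j == k) = false -> (j < k)%N.
  by move=> jk /negbT jk'; rewrite ltn_neqAle jk'.
split=> [j jk|i j ik jk|j jk].
- by case: (eqVneq j k) => [//|/negbTE jk']; apply: eS; exact: ltk.
- case: (eqVneq i k) => [->|/negbTE ik']; case: (eqVneq j k) => [jE|/negbTE jk'].
  + by rewrite ?eqxx (ipZl ipP) (ipZr ipP) mulrA tt mulVf// gt_eqF.
  + by rewrite (ipZl ipP) fu ?ltk// mulr0 ?(eq_sym k) ?jk'.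
  + by rewrite (ipC ipP) (ipZl ipP) fu ?ltk// mulr0 jE ik'.
  + by rewrite uu ?ltk.
- case: (eqVneq j k) => [_|/negbTE jk'] g; last by apply: ue; exact: ltk.
  by rewrite HZ !(ipZl ipP) Hf mulrCA.
Qed.

Lemma has_eigensystem_opp (H H' : E -> E) (S S' : set R) k :
  (forall f, H' f = - H f) -> (forall x, S x -> S' (- x)) ->
  has_eigensystem H S k -> has_eigensystem H' S' k.
Proof.
move=> HH SS [u [e [h1 h2 h3]]]; exists u, (fun j => - e j); split => //.
- by move=> j /h1; exact: SS.
- by move=> j jk g; rewrite HH (ipNl ipP) h3// mulNr.
Qed.

Lemma has_eigensystemS (H : E -> E) (S S' : set R) k :
  S `<=` S' -> has_eigensystem H S k -> has_eigensystem H S' k.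
Proof.
by move=> SS [u [e [h1 h2 h3]]]; exists u, e; split => // j /h1; exact: SS.
Qed.

(** The coefficients are taken in the left kernel of the matrix of the [ip (f i) (u j)]. By
    orthonormality of the [f i], the form minus [a * ip f0 f0] is the sum of the
    [(e j - a) * c_j^2], which is negative since [c] is nonzero. *)
Lemma negative_combination H a n (f : nat -> E) (e : nat -> R) (k : nat)
    (u : nat -> E) :
  (forall f g, H (f + g) = H f + H g) -> (forall c f, H (c *: f) = c *: H f) ->
  orthonormal_eigensystem H [set x | x < a] n f e -> (k < n)%N ->
  exists f0, ip (H f0) f0 < a * ip f0 f0 /\
    forall j, (j < k)%N -> ip f0 (u j) = 0.
Proof.
move=> HD HZ [ea ff fe] kn.
have [c c0 cM] := left_kernel_nontrivial
  (\matrix_(i < n, j < k) ip (f i) (u j)) kn.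
pose f0 := \sum_(i < n) c ord0 i *: f i.
have ipf0 g : ip f0 g = \sum_(i < n) c ord0 i * ip (f i) g.
  by rewrite (ip_suml ipP); apply: eq_bigr => i _; rewrite (ipZl ipP).
have ipff (i : 'I_n) : ip (f i) f0 = c ord0 i.
  rewrite (ipC ipP) ipf0 (bigD1 i)//= big1 ?addr0 => [|j ji].
    by rewrite ff// eqxx mulr1.
  by rewrite ff// [_ == _ :> nat](negbTE ji) mulr0.
exists f0; split.
  have -> : H f0 = \sum_(i < n) c ord0 i *: H (f i).
    rewrite (big_morph H HD (_ : H 0 = 0)); last by rewrite -(scale0r 0) HZ !scale0r.
    by apply: eq_bigr => i _; rewrite HZ.
  rewrite (ip_suml ipP) ipf0 mulr_sumr -subr_lt0 -sumrB.
  have [i ci] : exists i : 'I_n, c ord0 i != 0.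
    apply/existsP; rewrite -negb_forall; apply: contra c0 => /forallP h.
    by apply/eqP/rowP => i; rewrite mxE; exact/eqP/h.
  have term (j : 'I_n) : ip (c ord0 j *: H (f j)) f0 - a * (c ord0 j * ip (f j) f0) =
     (e j - a) * c ord0 j ^+ 2.
    by rewrite (ipZl ipP) (fe _ (ltn_ord j)) ipff; ring.
  have ea0 (j : 'I_n) : e j - a < 0 by rewrite subr_lt0; exact: ea.
  rewrite (bigD1 i)//= term -[ltRHS]addr0; apply: ltr_leD.
    by rewrite nmulr_rlt0// lt0r sqr_ge0 sqrf_eq0 ci.
  apply: sumr_le0 => j _; by rewrite term nmulr_rle0// sqr_ge0.
move=> j jk; rewrite ipf0.
have := congr1 (fun A : 'rV_k => A ord0 (Ordinal jk)) cM; rewrite !mxE => h; rewrite -[RHS]h.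
by apply: eq_bigr => i _; rewrite mxE.
Qed.

(* By induction on [k]: fewer than [n] eigenvectors of the second operator are
   orthogonal to some vector on which the form of the first one is below [a0]. *)
Lemma has_eigensystem_le N (v : 'I_N -> R) (psi : 'I_N -> E)
    (D0 D1 : E -> E) (a0 a1 : R) n :
  semibounded ip D0 a0 -> semibounded ip D1 a1 ->
  (forall f, ip (D1 f) f - a1 * ip f f <= ip (D0 f) f - a0 * ip f f) ->
  has_eigensystem (ham ip v psi D0) [set x | x < a0] n ->
  has_eigensystem (ham ip v psi D1) [set x | x < a1] n.
Proof.
move=> D0P D1P D01 [f [e fe]].
have hk : forall k, (k <= n)%N -> has_eigensystem (ham ip v psi D1) [set x | x < a1] k.
  elim=> [_|k IH kn]; first by exists (fun=> 0), (fun=> 0); split.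
  have [u [e1 ue1]] := IH (ltnW kn).
  have [f0 [f0lt f0u]] := negative_combination u (hamD ipP v psi D0P)
    (hamZ ipP v psi D0P) fe kn.
  (* Both operators have the same finite-rank part, which cancels in the comparison. *)
  have f0lt1 : ip (ham ip v psi D1 f0) f0 < a1 * ip f0 f0.
    by have := D01 f0; move: f0lt; rewrite /ham !(ipDl ipP); lra.
  have [_ _ ue] := ue1.
  have [w [x [xa Hw ww wu]]] := exists_eigenvector ipP D1P ue f0u f0lt1.
  apply: (@has_eigensystem_extend _ _ _ u e1 x w) => //; first exact: (hamZ ipP v psi D1P).
    by move=> g; rewrite Hw (ipZl ipP).
  by rewrite ww.
exact: hk.
Qed.

End EigenSystems.

(** * Square-integrable functions on the torus *)

Section RealL2.
Context {R : realType}.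
Local Notation mR := (measurableTypeR R).
Local Notation T2 := (mR * mR)%type.
Local Notation torus := (@torus R).
Local Notation leb2 := (@leb2 R).

Lemma measurable_torus : measurable torus.
Proof. by apply: measurableX; exact: measurable_itv. Qed.
Hint Resolve measurable_torus : core.

Lemma ae_torusW (P : T2 -> Prop) : (forall p, torus p -> P p) -> ae_torus P.
Proof. by move=> h; exact: aeW. Qed.

Lemma ae_torusS2 (P Q S : T2 -> Prop) :
  (forall p, torus p -> P p -> Q p -> S p) -> ae_torus P -> ae_torus Q -> ae_torus S.
Proof.
rewrite /ae_torus => h hP hQ.
by apply: filterS2 hP hQ => p hP hQ tp; apply: h => //; [exact: hP|exact: hQ].
Qed.

Lemma ae_torusS (P Q : T2 -> Prop) :
  (forall p, torus p -> P p -> Q p) -> ae_torus P -> ae_torus Q.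
Proof. by move=> h hP; apply: (ae_torusS2 _ hP hP) => p tp Pp _; exact: h. Qed.

Lemma leb2_box (a b c d : R) : a <= b -> c <= d ->
  leb2 ([set` `]a, b[] `*` [set` `]c, d[]) = ((b - a) * (d - c))%:E.
Proof.
have itv x y : x <= y -> (@lebesgue_measure R) [set` `]x, y[] = (y - x)%:E.
  rewrite lebesgue_measure_itv/= lte_fin le_eqVlt => /predU1P[->|->].
    by rewrite ltxx subrr.
  by rewrite EFinB.
by move=> ab cd; rewrite /leb2 product_measure1E// EFinM; congr (_ * _)%E; exact: itv.
Qed.

Lemma leb2_torus_lty : (leb2 torus < +oo)%E.
Proof.
rewrite /leb2 /Defs.torus product_measure1E//=.
rewrite !lebesgue_measure_itv/= lte_fin; case: ifP => _; last by rewrite mul0e ltry.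
by rewrite -EFinB -EFinM ltry.
Qed.

Definition square_integrable (f : T2 -> R) : Prop :=
  measurable_fun torus f /\ (\int[leb2]_(p in torus) ((f p) ^+ 2)%:E < +oo)%E.

Lemma integrable_dominated (f g : T2 -> R) :
  measurable_fun torus f -> measurable_fun torus g ->
  (forall p, torus p -> `|f p| <= g p) ->
  (\int[leb2]_(p in torus) (g p)%:E < +oo)%E -> leb2.-integrable torus (EFin \o f).
Proof.
move=> mf mg fg gfin; apply/integrableP; split; first exact/measurable_EFinP.
apply: le_lt_trans gfin; apply: ge0_le_integral => //.
- by apply/measurable_EFinP; apply: measurableT_comp.
- exact/measurable_EFinP.
Qed.

Lemma integrable_sqr f : square_integrable f ->
  leb2.-integrable torus (EFin \o (fun p => f p ^+ 2)).
Proof.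
move=> [mf ffin]; apply: (integrable_dominated _ _ _ ffin).
- exact: measurable_funX.
- exact: measurable_funX.
- by move=> p _; rewrite ger0_norm// sqr_ge0.
Qed.

Lemma integrable_mul f g : square_integrable f -> square_integrable g ->
  leb2.-integrable torus (EFin \o (fun p => f p * g p)).
Proof.
move=> [mf ff] [mg gg].
apply: (@integrable_dominated _ (fun p => f p ^+ 2 + g p ^+ 2)).
- exact: measurable_funM.
- by apply: measurable_funD; exact: measurable_funX.
- move=> p _; rewrite ler_norml.
  have := sqr_ge0 (f p + g p); have := sqr_ge0 (f p - g p).
  have := sqr_ge0 (f p); have := sqr_ge0 (g p).
  by rewrite sqrrB sqrrD => *; apply/andP; split; lra.
- under eq_integral do rewrite EFinD.
  rewrite ge0_integralD//; first exact: lte_add_pinfty.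
  + by move=> p _; rewrite lee_fin sqr_ge0.
  + by apply/measurable_EFinP; exact: measurable_funX.
  + by move=> p _; rewrite lee_fin sqr_ge0.
  + by apply/measurable_EFinP; exact: measurable_funX.
Qed.

Lemma square_integrable_le (f g : T2 -> R) C : measurable_fun torus f ->
  square_integrable g ->
  (forall p, torus p -> `|f p| <= C * `|g p|) -> square_integrable f.
Proof.
move=> mf gP fg; split => //.
have [mg _] := gP.
have Ig := integrableZl measurable_torus (C ^+ 2) (integrable_sqr gP).
apply: le_lt_trans (_ : _ <= \int[leb2]_(p in torus) (C ^+ 2 * g p ^+ 2)%:E)%E _.
  apply: ge0_le_integral => //.
  + by move=> p _; rewrite lee_fin sqr_ge0.
  + by apply/measurable_EFinP; exact: measurable_funX.
  + by apply/measurable_EFinP; apply: measurable_funM => //; exact: measurable_funX.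
  + move=> p /fg h; rewrite lee_fin -exprMn.
    rewrite -(real_normK (num_real (f p))) -(real_normK (num_real (C * g p))).
    rewrite ler_sqr ?nnegrE// normrM; apply: le_trans h _.
    by rewrite ler_wpM2r// ler_norm.
under eq_integral do rewrite EFinM.
exact: (integrable_lty measurable_torus Ig).
Qed.

Lemma square_integrableD f g : square_integrable f -> square_integrable g ->
  square_integrable (fun p => f p + g p).
Proof.
move=> fP gP; have [mf _] := fP; have [mg _] := gP.
split; first exact: measurable_funD.
have I1 := integrableD measurable_torus (integrable_sqr fP) (integrable_sqr gP).
(* The majorant [2 f^2 + 2 g^2], as two copies of [f^2 + g^2]. *)
have I2 := integrableD measurable_torus I1 I1.
apply: le_lt_trans (integrable_lty measurable_torus I2).
apply: ge0_le_integral => //.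
- by move=> p _; rewrite lee_fin sqr_ge0.
- by apply/measurable_EFinP; apply: measurable_funX; exact: measurable_funD.
- by have /measurable_int := I2.
- move=> p _ /=; rewrite -!EFinD lee_fin.
  have := sqr_ge0 (f p - g p); rewrite sqrrB sqrrD; lra.
Qed.

Lemma square_integrableZ c f : square_integrable f ->
  square_integrable (fun p => c * f p).
Proof.
move=> fP; have [mf _] := fP; apply: (@square_integrable_le _ f `|c|) => //.
  exact: measurable_funM.
by move=> p _; rewrite normrM.
Qed.

Lemma square_integrable_bounded (f : T2 -> R) C : measurable_fun torus f ->
  (forall p, torus p -> `|f p| <= C) -> square_integrable f.
Proof.
move=> mf fC; apply: (@square_integrable_le _ (fun=> 1) C) => //.
  split=> //; under eq_integral do rewrite expr1n.
  by rewrite integral_cst// mul1e leb2_torus_lty.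
by move=> p /fC; rewrite normr1 mulr1.
Qed.

End RealL2.
#[global] Hint Resolve measurable_torus : core.

(** * The real space of odd square-integrable functions *)

Section OddL2.
Context {R : realType}.
Local Notation mR := (measurableTypeR R).
Local Notation T2 := (mR * mR)%type.
Local Notation torus := (@torus R).
Local Notation leb2 := (@leb2 R).

Definition odd_square_integrable (f : T2 -> R) : Prop :=
  square_integrable f /\ ae_torus (fun p => f (- p) = - f p).

(** The codomain [R^o] makes these functions a module over [R]. No quotient by null functions is
    taken, whence the semi-inner product. *)
Definition oddL2_pred : {pred (R * R -> R^o)} :=
  fun f => `[< odd_square_integrable f >].

Lemma oddL2_submod_closed : submod_closed oddL2_pred.
Proof.
split=> [|c f g].
  apply/asboolP; split.
    apply: (@square_integrable_bounded R (cst 0) 0) => [|p _].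
      exact: measurable_cst.
    by rewrite normr0.
  by apply: ae_torusW => p _; rewrite -[0]/(cst 0) oppr0.
move=> /asboolP[fs fo] /asboolP[gs go]; apply/asboolP; split.
  by apply: square_integrableD => //; exact: square_integrableZ.
by apply: ae_torusS2 fo go => p _ fo go; rewrite !fctE fo go scalerN opprD.
Qed.

HB.instance Definition _ :=
  GRing.isSubmodClosed.Build R (R * R -> R^o) oddL2_pred oddL2_submod_closed.

Record oddL2 := OddL2 { oddL2_val :> R * R -> R^o; _ : oddL2_val \in oddL2_pred }.
HB.instance Definition _ := [isSub for oddL2_val].
HB.instance Definition _ := [Choice of oddL2 by <:].
HB.instance Definition _ := [SubChoice_isSubLmodule of oddL2 by <:].

Lemma oddL2P (f : oddL2) : odd_square_integrable f.
Proof. exact/asboolP/(valP f). Qed.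

Definition mk_oddL2 (f : R * R -> R) (fP : odd_square_integrable f) : oddL2 :=
  OddL2 (asboolT fP).

Lemma oddL2D (f g : oddL2) p : (f + g) p = f p + g p.
Proof. by []. Qed.

Lemma oddL2Z c (f : oddL2) p : (c *: f) p = c * f p.
Proof. by []. Qed.

Lemma oddL2N (f : oddL2) p : (- f) p = - f p.
Proof. by []. Qed.

Lemma oddL2_sum (I : Type) (r : seq I) (P : pred I) (F : I -> oddL2) p :
  (\sum_(i <- r | P i) F i) p = \sum_(i <- r | P i) F i p.
Proof. by elim/big_ind2 : _ => // f a g b <- <-. Qed.

Lemma oddL2_inj (f g : oddL2) : (forall p, f p = g p) -> f = g.
Proof. by move=> fg; apply/val_inj/funext. Qed.

Definition rinner (f g : oddL2) : R := \int[leb2]_(p in torus) (f p * g p).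

Lemma rinner_integrable (f g : oddL2) :
  leb2.-integrable torus (EFin \o (fun p => f p * g p)).
Proof. by apply: integrable_mul; [have [] := oddL2P f|have [] := oddL2P g]. Qed.

Lemma rinner_semi_inner : semi_inner rinner.
Proof.
split=> [f g|f g h|c f g|f].
- by apply: eq_Rintegral => p _; rewrite mulrC.
- rewrite /rinner -RintegralD//; try exact: rinner_integrable.
  by apply: eq_Rintegral => p _; rewrite oddL2D mulrDl.
- rewrite /rinner -RintegralZl//; last exact: rinner_integrable.
  by apply: eq_Rintegral => p _; rewrite oddL2Z mulrA.
- by apply: Rintegral_ge0 => p _; rewrite -expr2 sqr_ge0.
Qed.

Lemma ae_eq_rinner (f g h : oddL2) :
  ae_torus (fun p => f p = g p) -> rinner f h = rinner g h.
Proof.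
rewrite /ae_torus => fg; congr fine; apply: ae_eq_integral => //.
- exact: measurable_int (rinner_integrable f h).
- exact: measurable_int (rinner_integrable g h).
- by apply: filterS fg => p fg tp; rewrite fg.
Qed.

Lemma rinner_ae_eq0 (f : oddL2) : rinner f f = 0 -> ae_torus (fun p => f p = 0).
Proof.
rewrite /ae_torus => f0.
have If := rinner_integrable f f.
have : (\int[leb2]_(p in torus) `|(EFin \o (fun p => (f p * f p)%R)) p| = 0)%E.
  transitivity (\int[leb2]_(p in torus) (f p * f p)%:E)%E.
    by apply: eq_integral => p _ /=; rewrite ger0_norm// -expr2 sqr_ge0.
  have fin := integrable_fin_num measurable_torus If.
  by rewrite -[LHS](fineK fin); congr EFin.
move/(ae_eq_integral_abs leb2 measurable_torus (measurable_int _ If)).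
by apply: filterS => p h /h/= [] /eqP; rewrite mulf_eq0 orbb => /eqP.
Qed.

(** Test against [f - g] itself. Together with [ae_eq_rinner] this matches almost-everywhere
    eigenvalue equations with the tested form in [eigenvector]. *)
Lemma rinner_ae_eq (f g : oddL2) :
  (forall h, rinner f h = rinner g h) -> ae_torus (fun p => f p = g p).
Proof.
move=> fg; have : rinner (f - g) (f - g) = 0.
  by rewrite (ipBl rinner_semi_inner) fg subrr.
move/rinner_ae_eq0; apply: ae_torusS => p _; rewrite oddL2D oddL2N.
by move/eqP; rewrite subr_eq0 => /eqP.
Qed.

End OddL2.
Arguments oddL2 : clear implicits.

(** * Complex functions as pairs of real ones *)

Section Complexification.
Context {R : realType}.
Local Notation mR := (measurableTypeR R).
Local Notation T2 := (mR * mR)%type.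
Local Notation torus := (@torus R).
Local Notation leb2 := (@leb2 R).
Local Notation fct := (R * R -> R[i]).
Local Notation ip := (@rinner R).

Definition cplx (a b : oddL2 R) : fct := fun p => (a p +i* b p)%C.

Lemma L2odd_cplx (a b : oddL2 R) : L2odd (cplx a b).
Proof.
have [sa oa] := oddL2P a; have [sb ob] := oddL2P b.
have [ma _] := sa; have [mb _] := sb.
split => //.
- have I := integrableD measurable_torus (integrable_sqr sa) (integrable_sqr sb).
  have := integrable_lty measurable_torus I; apply: le_lt_trans.
  by rewrite le_eqVlt; apply/orP; left; apply/eqP/eq_integral => p _ /=; rewrite EFinD.
- by apply: ae_torusS2 oa ob => p _ oa ob; rewrite /cplx oa ob.
Qed.

Lemma L2oddE (F : fct) : L2odd F -> exists a b : oddL2 R, F = cplx a b.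
Proof.
case=> mr mi fin od.
have m2 (f : T2 -> R) : measurable_fun torus f ->
    measurable_fun torus (fun p => (f p ^+ 2)%:E).
  by move=> mf; apply/measurable_EFinP; exact: measurable_funX.
have mF : measurable_fun torus (fun p => (sqnormc (F p))%:E).
  apply/measurable_EFinP; rewrite /sqnormc.
  by apply: measurable_funD; exact: measurable_funX.
have ra : odd_square_integrable (fun p => complex.Re (F p)).
  split; last by apply: ae_torusS od => p _ ->; case: (F p).
  split => //; apply: le_lt_trans fin; apply: ge0_le_integral => //.
  - by move=> p _; rewrite lee_fin sqr_ge0.
  - exact: m2.
  - by move=> p _; rewrite lee_fin /sqnormc lerDl sqr_ge0.
have rb : odd_square_integrable (fun p => complex.Im (F p)).
  split; last by apply: ae_torusS od => p _ ->; case: (F p).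
  split => //; apply: le_lt_trans fin; apply: ge0_le_integral => //.
  - by move=> p _; rewrite lee_fin sqr_ge0.
  - exact: m2.
  - by move=> p _; rewrite lee_fin /sqnormc lerDr sqr_ge0.
exists (mk_oddL2 ra), (mk_oddL2 rb); apply/funext => p.
by rewrite /cplx /=; case: (F p).
Qed.

Lemma L2norm_cplx (a b : oddL2 R) : L2norm (cplx a b) = Num.sqrt (ip a a + ip b b).
Proof.
by rewrite /L2norm /rinner -RintegralD//; exact: rinner_integrable.
Qed.

Lemma inner_cplx (a b c d : oddL2 R) :
  inner (cplx a b) (cplx c d) = Complex (ip a c + ip b d) (ip b c - ip a d).
Proof.
rewrite /inner /cintegral /rinner -RintegralD//; try exact: rinner_integrable.
rewrite -RintegralB//; try exact: rinner_integrable.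
congr Complex; apply: eq_Rintegral => p _ /=; ring.
Qed.

Lemma ae_cplx (a b c d : oddL2 R) :
  ae_torus (fun p => cplx a b p = cplx c d p) <->
  ae_torus (fun p => a p = c p) /\ ae_torus (fun p => b p = d p).
Proof.
split=> [h|[h1 h2]].
  by split; apply: ae_torusS h => p _ [].
by apply: ae_torusS2 h1 h2 => p _ h1 h2; rewrite /cplx h1 h2.
Qed.

Lemma cplxZ x (a b : oddL2 R) p : (x%:C)%C * cplx a b p = cplx (x *: a) (x *: b) p.
Proof. by rewrite /cplx /=; simpc. Qed.

Lemma cplx_sum k (c : 'I_k -> R[i]) (a b : 'I_k -> oddL2 R) p :
  \sum_(j < k) c j * cplx (a j) (b j) p =
  cplx (\sum_(j < k) (complex.Re (c j) *: a j - complex.Im (c j) *: b j))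
       (\sum_(j < k) (complex.Re (c j) *: b j + complex.Im (c j) *: a j)) p.
Proof.
rewrite /cplx !oddL2_sum; elim/big_ind3 : _ => // [x y z x' y' z' -> ->//|j _].
by case: (c j) => r s; rewrite /cplx /=; simpc.
Qed.

(** As [x] is real and [A] acts separately on both components, the equation splits. *)
Lemma in_eigenspace_cplx (A : fct -> fct) (H : oddL2 R -> oddL2 R) x (a b : oddL2 R) :
  (forall a b, A (cplx a b) = cplx (H a) (H b)) ->
  in_eigenspace A x (cplx a b) <-> eigenvector ip H x a /\ eigenvector ip H x b.
Proof.
have ev f : ae_torus (fun p => H f p = (x *: f) p) <-> eigenvector ip H x f.
  split=> [h g|h]; first by rewrite (ae_eq_rinner _ h) (ipZl rinner_semi_inner).
  by apply: rinner_ae_eq => g; rewrite h (ipZl rinner_semi_inner).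
move=> AH; rewrite /in_eigenspace AH; split.
  move=> [_ h]; have /ae_cplx[/ev ? /ev ?] : ae_torus
    (fun p => cplx (H a) (H b) p = cplx (x *: a) (x *: b) p) => //.
  by apply: ae_torusS h => p _ ->; rewrite cplxZ.
move=> [/ev h1 /ev h2]; split; first exact: L2odd_cplx.
by apply: ae_torusS2 h1 h2 => p _ h1 h2; rewrite cplxZ /cplx h1 h2.
Qed.

End Complexification.

(** * Multiplication by bounded even functions *)

Section Multiplier.
Context {R : realType}.
Local Notation mR := (measurableTypeR R).
Local Notation T2 := (mR * mR)%type.
Local Notation torus := (@torus R).
Local Notation leb2 := (@leb2 R).
Local Notation ip := (@rinner R).

Record multiplier (w : T2 -> R) : Prop := Multiplier {
  multiplier_measurable : measurable_fun torus w ;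
  multiplier_bounded : exists C, forall p, `|w p| <= C ;
  multiplier_even : forall p, w (- p) = w p }.

Lemma multiplier_odd w f : multiplier w -> odd_square_integrable f ->
  odd_square_integrable (fun p => w p * f p).
Proof.
move=> [mw [C wC] we] [fs fo]; have [mf _] := fs; split.
  apply: (@square_integrable_le _ _ f C) => //; first exact: measurable_funM.
  by move=> p _; rewrite normrM ler_wpM2r.
by apply: ae_torusS fo => p _ ->; rewrite we mulrN.
Qed.

Definition mulop w (wP : multiplier w) (f : oddL2 R) : oddL2 R :=
  mk_oddL2 (multiplier_odd wP (oddL2P f)).

Lemma multiplierN w : multiplier w -> multiplier (fun p => - w p).
Proof.
move=> [mw [C wC] we]; split; first exact: measurable_funN.
- by exists C => p; rewrite normrN.
- by move=> p; rewrite we.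
Qed.

Lemma multiplierB_inv w a e : multiplier w -> (forall p, a <= w p) -> e < a ->
  multiplier (fun p => (w p - e)^-1).
Proof.
move=> [mw [C wC] we] aw ea; split.
(* On nonnegative arguments the inverse is the real power with exponent -1, which is measurable. *)
- have -> : (fun p => (w p - e)^-1) = (@powR R ^~ (-1)) \o (fun p => w p - e).
    apply/funext => p /=; rewrite powR_inv1// subr_ge0.
    exact: le_trans (ltW ea) (aw p).
  apply: measurableT_comp; first exact: measurable_powR.
  exact: measurable_funB.
- exists (a - e)^-1 => p.
  have h : 0 < w p - e by rewrite subr_gt0; exact: lt_le_trans (aw p).
  rewrite ger0_norm ?invr_ge0 ?(ltW h)// lef_pV2 ?posrE ?h ?subr_gt0//.
  by rewrite lerD2r.
- by move=> p; rewrite we.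
Qed.

(** The resolvent at [e < a] is multiplication by [(w p - e)^-1], which is bounded by
    [(a - e)^-1]. *)
Lemma semibounded_mulop w (wP : multiplier w) a : (forall p, a <= w p) ->
  semibounded ip (mulop wP) a.
Proof.
move=> aw; have [mw [C wC] we] := wP.
have intw (f : oddL2 R) : leb2.-integrable torus (EFin \o (fun p => w p * f p * f p)).
  exact: (rinner_integrable (mulop wP f) f).
split.
- by move=> f g; apply: oddL2_inj => p; rewrite /= mulrDr.
- by move=> c f; apply: oddL2_inj => p; rewrite /= mulrCA.
- by move=> f g; apply: eq_Rintegral => p _ /=; ring.
- move=> f; rewrite -(ipZl rinner_semi_inner); apply: le_Rintegral => //.
  + exact: rinner_integrable.
  + exact: rinner_integrable.
  + by move=> p _; rewrite oddL2Z /= -!mulrA -expr2 ler_wpM2r ?sqr_ge0.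
- exists C => f; rewrite -(ipZl rinner_semi_inner); apply: le_Rintegral => //.
  + exact: rinner_integrable.
  + exact: rinner_integrable.
  + move=> p _; rewrite oddL2Z /= -!mulrA -expr2 ler_wpM2r ?sqr_ge0//.
    exact: le_trans (ler_norm _) (wC p).
- move=> e ea h; exists (mulop (multiplierB_inv wP aw ea) h).
  apply: oddL2_inj => p; rewrite oddL2D oddL2N oddL2Z /=.
  rewrite !mulrA -mulrBl -mulrBl mulfV ?mul1r// gt_eqF// subr_gt0.
  exact: lt_le_trans (aw p).
Qed.

End Multiplier.

(** * Eigenvalue counting and essential spectrum *)

Section Multiplicity.
Context {R : realType}.
Local Notation fct := (R * R -> R[i]).
Local Notation ip := (@rinner R).
Local Notation ipP := (@rinner_semi_inner R).
Context (A : fct -> fct) (H : oddL2 R -> oddL2 R) (S : set R).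
Hypothesis AH : forall a b, A (cplx a b) = cplx (H a) (H b).
Hypothesis HD : forall f g, H (f + g) = H f + H g.
Hypothesis HZ : forall c f, H (c *: f) = c *: H f.
Hypothesis Hsym : forall f g, ip (H f) g = ip f (H g).

Definition occurrences (k : nat) (e : nat -> R) (x : R) : nat :=
  (\sum_(j < k) (e j == x))%N.

Lemma sum_occurrences k e s : uniq s ->
  (\sum_(x <- s) occurrences k e x = \sum_(j < k) (e j \in s))%N.
Proof.
move=> us; rewrite /occurrences exchange_big/=; apply: eq_bigr => j _.
rewrite -count_uniq_mem// -sum1_count [RHS]big_mkcond/=.
by apply: eq_bigr => x _; rewrite /= eq_sym; case: eqP.
Qed.

Lemma card_occurrences k (e : nat -> R) x : #|[pred j : 'I_k | e j == x]| = occurrences k e x.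
Proof.
rewrite -sum1_card [LHS]big_mkcond/=; apply: eq_bigr => j _.
by rewrite inE; case: (e j == x).
Qed.

(** The vectors [u j] with [e j = x], taken with imaginary part 0, are independent over the complex
    numbers: pairing with each of them recovers the real and imaginary parts of its coefficient. *)
Lemma multiplicity_ge k u e x : orthonormal_eigensystem ip H S k u e ->
  ((occurrences k e x)%:R%:E <= multiplicity A x)%E.
Proof.
move=> [eS uu ue]; rewrite -card_occurrences.
apply: ereal_sup_ubound; exists #|[pred j : 'I_k | e j == x]| => //.
set l := #|_|; pose f (j : 'I_l) := enum_val j : 'I_k.
have fx j : e (f j) = x by have := enum_valP j; rewrite inE => /eqP.
exists (fun j => cplx (u (f j)) 0); split; last first.
  move=> j; apply/(in_eigenspace_cplx _ _ _ AH); split.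
    by rewrite -(fx j); apply: ue.
  by move=> g; rewrite -(scale0r 0) HZ !(ipZl ipP) !mul0r mulr0.
move=> c c0 i.
have /(ae_cplx _ _ 0 0)[re im] : ae_torus (fun p =>
    cplx (\sum_(j < l) (complex.Re (c j) *: u (f j) - complex.Im (c j) *: 0))
         (\sum_(j < l) (complex.Re (c j) *: 0 + complex.Im (c j) *: u (f j))) p
    = cplx 0 0 p).
  by apply: ae_torusS c0 => p _; rewrite cplx_sum => ->.
have coef (d : 'I_l -> R) : ip (\sum_(j < l) d j *: u (f j)) (u (f i)) = d i.
  rewrite (ip_suml ipP) (bigD1 i)//= (ipZl ipP) uu// eqxx mulr1 big1 ?addr0// => j ji.
  rewrite (ipZl ipP) uu// (_ : _ == _ = false) ?mulr0//.
  by apply/negbTE; apply: contra ji => /eqP/val_inj/enum_val_inj ->.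
have imc : complex.Im (c i) = 0.
  rewrite -(coef (fun j => complex.Im (c j))) -[RHS](ip0l ipP (u (f i))).
  rewrite -(ae_eq_rinner _ im); congr rinner.
  by apply: eq_bigr => j _; rewrite scaler0 add0r.
have rec : complex.Re (c i) = 0.
  rewrite -(coef (fun j => complex.Re (c j))) -[RHS](ip0l ipP (u (f i))).
  rewrite -(ae_eq_rinner _ re); congr rinner.
  by apply: eq_bigr => j _; rewrite scaler0 subr0.
by apply/eqP; rewrite eq_complex rec imc !eqxx.
Qed.

(** The set of distinct [e j] is finite and contained in [S], and the occurrences over it add up to
    [k]. *)
Lemma eigensystem_le_num k : has_eigensystem ip H S k ->
  (k%:R%:E <= \esum_(x in S) multiplicity A x)%E.
Proof.
move=> [u [e ue]]; have [eS _ _] := ue.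
pose s := undup [seq e j | j <- iota 0 k].
have es j : (j < k)%N -> e j \in s.
  by move=> jk; rewrite mem_undup map_f// mem_iota.
apply: esum_ge; exists [set` s].
  split; first exact: finite_seq.
  by move=> x /=; rewrite mem_undup => /mapP[j]; rewrite mem_iota => jk ->; exact: eS.
rewrite -fsbig_seq ?undup_uniq//.
apply: (@le_trans _ _ (\sum_(x <- s) (occurrences k e x)%:R%:E)%E); last first.
  by apply: lee_sum => x _; exact: multiplicity_ge ue.
rewrite sumEFin -natr_sum sum_occurrences ?undup_uniq// lee_fin ler_nat.
by rewrite -[leqLHS]card_ord -sum1_card leq_sum// => j _; rewrite es.
Qed.

Lemma eigenvectorD x f g : eigenvector ip H x f -> eigenvector ip H x g ->
  eigenvector ip H x (f + g).
Proof. by move=> hf hg h; rewrite HD !(ipDl ipP) hf hg mulrDr. Qed.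

Lemma eigenvectorZ x c f : eigenvector ip H x f -> eigenvector ip H x (c *: f).
Proof. by move=> hf h; rewrite HZ !(ipZl ipP) hf mulrCA. Qed.

Lemma eigenvector_sum x (I : finType) (F : I -> oddL2 R) :
  (forall i, eigenvector ip H x (F i)) -> eigenvector ip H x (\sum_i F i).
Proof.
move=> hF; elim/big_ind : _ => //; last exact: eigenvectorD.
by move=> g; rewrite -(scale0r 0) HZ !(ipZl ipP) !mul0r mulr0.
Qed.

Lemma sum_Complex k (c : 'I_k -> R[i]) (al be : 'I_k -> R) :
  \sum_(j < k) c j * Complex (al j) (be j) =
  Complex (\sum_(j < k) (complex.Re (c j) * al j - complex.Im (c j) * be j))
          (\sum_(j < k) (complex.Re (c j) * be j + complex.Im (c j) * al j)).
Proof.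
elim/big_ind3 : _ => // [x y z x' y' z' -> ->//|j _].
by case: (c j) => r s; simpc.
Qed.

(* A larger eigenspace would contain a nonzero vector orthogonal to the whole
   system, and its real or imaginary part would extend the system. *)
Lemma multiplicity_le k u e x : orthonormal_eigensystem ip H S k u e ->
  ~ has_eigensystem ip H S k.+1 -> S x ->
  (multiplicity A x <= (occurrences k e x)%:R%:E)%E.
Proof.
move=> ue maxk Sx; have [eS uu uev] := ue; rewrite -card_occurrences.
apply: ge_ereal_sup => _ [l [g [g_indep g_eig]] <-].
rewrite lee_fin ler_nat leqNgt; apply/negP.
set n := #|_| => nl; pose f (j : 'I_n) := enum_val j : 'I_k.
have /choice[ab gab] (j : 'I_l) : exists ab : oddL2 R * oddL2 R, g j = cplx ab.1 ab.2.
  by have [/L2oddE[a [b ->]] _] := g_eig j; exists (a, b).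
pose a j := (ab j).1; pose b j := (ab j).2.
have abx j : eigenvector ip H x (a j) /\ eigenvector ip H x (b j).
  by apply/(in_eigenspace_cplx _ _ _ AH); rewrite -gab.
(* The kernel is taken over the complex numbers, because [g_indep] concerns complex coefficients. *)
have [c c0 cM] := left_kernel_nontrivial
  (\matrix_(j < l, i < n) Complex (ip (a j) (u (f i))) (ip (b j) (u (f i)))) nl.
pose ga := \sum_(j < l) (complex.Re (c ord0 j) *: a j - complex.Im (c ord0 j) *: b j).
pose gb := \sum_(j < l) (complex.Re (c ord0 j) *: b j + complex.Im (c ord0 j) *: a j).
have gax : eigenvector ip H x ga.
  apply: eigenvector_sum => j; have [ax bx] := abx j.
  by rewrite -scaleNr; apply: eigenvectorD; exact: eigenvectorZ.
have gbx : eigenvector ip H x gb.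
  apply: eigenvector_sum => j; have [ax bx] := abx j.
  by apply: eigenvectorD; exact: eigenvectorZ.
have orth_same (i : 'I_n) : ip ga (u (f i)) = 0 /\ ip gb (u (f i)) = 0.
  have := congr1 (fun M : 'rV_n => M ord0 i) cM; rewrite !mxE.
  under eq_bigr do rewrite mxE.
  rewrite sum_Complex => -[hr hi]; split.
    rewrite -[RHS]hr (ip_suml ipP); apply: eq_bigr => j _.
    by rewrite (ipBl ipP) !(ipZl ipP).
  rewrite -[RHS]hi (ip_suml ipP); apply: eq_bigr => j _.
  by rewrite (ipDl ipP) !(ipZl ipP).
(* By symmetry, eigenvectors for different eigenvalues are orthogonal, so only the [u j] with
   [e j = x] had to be treated by the kernel argument. *)
have orth_diff h (j : nat) : (j < k)%N -> eigenvector ip H x h -> e j != x -> ip h (u j) = 0.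
  move=> jk hx ex; have := hx (u j).
  rewrite Hsym (ipC ipP) uev// (ipC ipP (u j)) => /eqP.
  by rewrite -subr_eq0 -mulrBl mulf_eq0 subr_eq0 (negbTE ex) => /eqP.
have null h : eigenvector ip H x h -> (forall i, ip h (u (f i)) = 0) -> ip h h = 0.
  move=> hx hf; apply/eqP/negPn/negP => h0; apply: maxk.
  apply: (has_eigensystem_extend ipP HZ ue Sx hx).
    by rewrite lt0r h0 (ip_ge0 ipP).
  move=> j jk; have [ejx|ejx] := eqVneq (e j) x; last exact: orth_diff.
  have jin : Ordinal jk \in [pred j : 'I_k | e j == x] by rewrite inE; exact/eqP.
  by have := hf (enum_rank_in jin (Ordinal jk)); rewrite /f enum_rankK_in.
have ga0 := null _ gax (fun i => (orth_same i).1).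
have gb0 := null _ gbx (fun i => (orth_same i).2).
move/negP: c0; apply; apply/eqP/rowP => j; rewrite mxE.
apply: (g_indep (fun j => c ord0 j)).
have h : ae_torus (fun p => cplx ga gb p = cplx 0 0 p).
  by apply/ae_cplx; split; exact: rinner_ae_eq0.
apply: ae_torusS h => p _ h.
under eq_bigr do rewrite gab.
by rewrite cplx_sum h.
Qed.

Lemma num_le_eigensystem k u e : orthonormal_eigensystem ip H S k u e ->
  ~ has_eigensystem ip H S k.+1 ->
  (\esum_(x in S) multiplicity A x <= k%:R%:E)%E.
Proof.
move=> ue maxk; apply: ge_ereal_sup => _ [X [/finite_seqP[s ->] sS] <-].
have -> : [set` s] = [set` undup s] by apply/seteqP; split => x /=; rewrite mem_undup.
rewrite -fsbig_seq ?undup_uniq//.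
apply: (@le_trans _ _ (\sum_(x <- undup s) (occurrences k e x)%:R%:E)%E).
  rewrite big_seq [leRHS]big_seq; apply: lee_sum => x; rewrite mem_undup => xs.
  by apply: multiplicity_le ue maxk _; exact: sS.
rewrite sumEFin -natr_sum sum_occurrences ?undup_uniq// lee_fin ler_nat.
rewrite -[leqRHS]card_ord -sum1_card leq_sum// => j _; exact: leq_b1.
Qed.

(** If systems of length [k < n] exist but none of length [k + 1], then [num_le_eigensystem] bounds
    the count by [k]. *)
Lemma num_eq_has_eigensystem n :
  \esum_(x in S) multiplicity A x = n%:R%:E -> has_eigensystem ip H S n.
Proof.
move=> numE.
have hk k : (k <= n)%N -> has_eigensystem ip H S k.
  elim: k => [_|k IH kn]; first by exists (fun=> 0), (fun=> 0); split.
  have [u [e ue]] := IH (ltnW kn).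
  apply: contrapT => maxk.
  have := num_le_eigensystem ue maxk.
  by rewrite numE lee_fin ler_nat leqNgt kn.
exact: hk.
Qed.

End Multiplicity.

(** * Null sequences and Weyl sequences *)

Lemma cvg0_sum (R : realType) (N : nat) (t : 'I_N -> nat -> R) :
  (forall k, t k @ \oo --> (0 : R)) ->
  (fun m => \sum_(k < N) t k m) @ \oo --> (0 : R).
Proof.
move=> t0; rewrite [X in X @ _ --> _](_ : _ = \sum_(k < N) t k); last first.
  by apply/funext => m; rewrite fct_sumE.
elim/big_ind : _ => [|f g f0 g0|//]; first exact: cvg_cst.
have := cvgD f0 g0; rewrite addr0; apply.
Qed.

Lemma cvg0_lincomb (R : realType) (c d : R) (r s : nat -> R) :
  r @ \oo --> (0 : R) -> s @ \oo --> (0 : R) ->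
  (fun m => c * r m + d * s m) @ \oo --> (0 : R).
Proof.
move=> r0 s0; rewrite (_ : 0 = c * 0 + d * 0 :> R); last by rewrite !mulr0 addr0.
by apply: cvgD; apply: cvgM => //; exact: cvg_cst.
Qed.

Lemma cvg0_sqr (R : realType) (r : nat -> R) :
  r @ \oo --> (0 : R) -> (fun m => r m ^+ 2) @ \oo --> (0 : R).
Proof.
by move=> r0; have := cvgM r0 r0; rewrite mulr0; apply.
Qed.

Lemma cvg0_sqrt (R : realType) (r : nat -> R) :
  r @ \oo --> (0 : R) -> (fun m => Num.sqrt (r m)) @ \oo --> (0 : R).
Proof.
move=> r0; have := @continuous_cvg _ _ _ _ _ _ Num.sqrt _ (@sqrt_continuous R 0) r0.
by rewrite sqrtr0; apply.
Qed.

Section EssentialSpectrum.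
Context {R : realType}.
Local Notation mR := (measurableTypeR R).
Local Notation T2 := (mR * mR)%type.
Local Notation torus := (@torus R).
Local Notation leb2 := (@leb2 R).
Local Notation fct := (R * R -> R[i]).
Local Notation ip := (@rinner R).
Local Notation ipP := (@rinner_semi_inner R).
Context (N : nat) (v : 'I_N -> R) (psi : 'I_N -> oddL2 R) (w : T2 -> R).
Hypothesis wP : multiplier w.
Local Notation H := (ham ip v psi (mulop wP)).
Context (A : fct -> fct).
Hypothesis AH : forall a b, A (cplx a b) = cplx (H a) (H b).

Let G := \sum_(i < N) \sum_(j < N) `|v i * v j * ip (psi i) (psi j)|.

Lemma L2norm_residual y (a b : oddL2 R) :
  L2norm (fun p => A (cplx a b) p - (y%:C)%C * cplx a b p) =
  Num.sqrt (ip (H a - y *: a) (H a - y *: a) + ip (H b - y *: b) (H b - y *: b)).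
Proof.
rewrite -L2norm_cplx; congr L2norm; apply/funext => p.
by rewrite AH cplxZ /cplx; simpc.
Qed.

Lemma mulop_gap (del y : R) f : 0 < del -> (forall p, del <= `|w p - y|) ->
  del ^+ 2 * ip f f <= ip (mulop wP f - y *: f) (mulop wP f - y *: f).
Proof.
move=> del0 wy; rewrite -(ipZl ipP); apply: le_Rintegral => //.
- exact: rinner_integrable.
- exact: rinner_integrable.
- move=> p _; rewrite oddL2Z oddL2D oddL2N oddL2Z /=.
  have -> : (w p * f p - y * f p) * (w p * f p - y * f p) =
     (w p - y) ^+ 2 * (f p * f p) by ring.
  rewrite -mulrA ler_wpM2r -?expr2 ?sqr_ge0//.
  rewrite -(real_normK (num_real (w p - y))) ler_sqr ?nnegrE//; exact: ltW.
Qed.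

Lemma finite_rank_le f s : (forall k, `|ip f (psi k)| <= s) ->
  ip (finite_rank ip v psi f) (finite_rank ip v psi f) <= s ^+ 2 * G.
Proof. exact: (@ip_combination_le _ _ _ ipP _ v (fun k => ip f (psi k))). Qed.

(* The finite-rank part tends to 0 along a singular Weyl sequence, which is
   then one for the multiplication by [w]. *)
Lemma not_ess_spectrum (del y : R) : 0 < del -> (forall p, del <= `|w p - y|) ->
  ~ ess_spectrum A y.
Proof.
move=> del0 wy [u [uL u1 uw ur]].
have /choice[ab uab] m : exists ab : oddL2 R * oddL2 R, u m = cplx ab.1 ab.2.
  by have [a [b ->]] := L2oddE (uL m); exists (a, b).
pose a m := (ab m).1; pose b m := (ab m).2.
pose r m := L2norm (fun p => A (u m) p - (y%:C)%C * u m p).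
pose t k m := Num.sqrt (sqnormc (inner (u m) (cplx (psi k) 0))).
pose s m := \sum_(k < N) t k m.
have s0 : s @ \oo --> (0 : R).
  by apply: cvg0_sum => k; apply: uw; exact: L2odd_cplx.
have tE k m : t k m = Num.sqrt (ip (a m) (psi k) ^+ 2 + ip (b m) (psi k) ^+ 2).
  rewrite /t uab inner_cplx /sqnormc /= !(ipC ipP _ 0) !(ip0l ipP) addr0 subr0.
  by [].
have le_t k m : t k m <= s m.
  by rewrite /s (bigD1 k)//= lerDl sumr_ge0// => j _; exact: sqrtr_ge0.
have as_ m k : `|ip (a m) (psi k)| <= s m.
  apply: le_trans (le_t k m); rewrite tE -sqrtr_sqr ler_wsqrtr//.
  by rewrite lerDl sqr_ge0.
have bs_ m k : `|ip (b m) (psi k)| <= s m.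
  apply: le_trans (le_t k m); rewrite tE -sqrtr_sqr ler_wsqrtr//.
  by rewrite lerDr sqr_ge0.
(* Removing the finite-rank part costs a factor 2 in each component, and the two components together
   give [4 * G]. The right-hand side tends to 0. *)
have key m : del ^+ 2 <= 2 * r m ^+ 2 + 4 * G * s m ^+ 2.
  have n1 : ip (a m) (a m) + ip (b m) (b m) = 1.
    have := u1 m; rewrite uab L2norm_cplx => h.
    rewrite -[LHS]sqr_sqrtr ?h ?expr1n//.
    by rewrite addr_ge0 ?(ip_ge0 ipP).
  have r2 : r m ^+ 2 = ip (H (a m) - y *: a m) (H (a m) - y *: a m) +
      ip (H (b m) - y *: b m) (H (b m) - y *: b m).
    rewrite /r uab L2norm_residual sqr_sqrtr//.
    by rewrite addr_ge0 ?(ip_ge0 ipP).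
  have bound f : (forall k, `|ip f (psi k)| <= s m) ->
     del ^+ 2 * ip f f <= 2 * ip (H f - y *: f) (H f - y *: f) + 2 * (s m ^+ 2 * G).
    move=> fs; apply: le_trans (mulop_gap f del0 wy) _.
    have -> : mulop wP f - y *: f = (H f - y *: f) - finite_rank ip v psi f.
      by rewrite /ham addrAC addrK.
    apply: le_trans (ip_sqrB_le ipP _ _) _.
    by rewrite lerD2l ler_pM2l// finite_rank_le.
  have ha := bound _ (as_ m); have hb := bound _ (bs_ m).
  have del2 : del ^+ 2 = del ^+ 2 * ip (a m) (a m) + del ^+ 2 * ip (b m) (b m).
    by rewrite -mulrDr n1 mulr1.
  rewrite r2 {}del2; move: ha hb; lra.
have cv : (fun m => 2 * r m ^+ 2 + 4 * G * s m ^+ 2) @ \oo --> (0 : R).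
  by apply: cvg0_lincomb; exact: cvg0_sqr.
have := cvgr_lt (0 : R) cv (del ^+ 2) (exprn_gt0 _ del0).
by move=> /(_ _)/filter_ex[m]; rewrite ltNge key.
Qed.

(** Weak convergence to 0 makes the finite-rank part vanish in the limit, so a real Weyl sequence
    for multiplication by [w] is one for [A], with imaginary part 0. *)
Lemma weyl_ess_spectrum y (a : nat -> oddL2 R) :
  (forall m, ip (a m) (a m) = 1) ->
  (forall g, (fun m => ip (a m) g) @ \oo --> (0 : R)) ->
  (fun m => ip (mulop wP (a m) - y *: a m) (mulop wP (a m) - y *: a m)) @ \oo
    --> (0 : R) ->
  ess_spectrum A y.
Proof.
move=> a1 aw ar; exists (fun m => cplx (a m) 0); split.
- by move=> m; exact: L2odd_cplx.
- by move=> m; rewrite L2norm_cplx a1 (ip0l ipP) addr0 sqrtr1.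
- move=> _ /L2oddE[c [d ->]].
  apply: cvg0_sqrt.
  under eq_fun do rewrite inner_cplx /sqnormc /= !(ip0l ipP) addr0 sub0r sqrrN.
  have := cvgD (cvg0_sqr (aw c)) (cvg0_sqr (aw d)); rewrite addr0; apply.
- under eq_fun do rewrite L2norm_residual.
  apply: cvg0_sqrt.
  pose s m := \sum_(k < N) `|ip (a m) (psi k)|.
  have s0 : s @ \oo --> (0 : R).
    by apply: cvg0_sum => k; have := cvg_norm (aw (psi k)); rewrite normr0; apply.
  pose r m := ip (mulop wP (a m) - y *: a m) (mulop wP (a m) - y *: a m).
  apply: (@squeeze_cvgr _ _ _ _ (cst 0) (fun m => 2 * r m + 2 * (G * s m ^+ 2))).
  + apply: nearW => m; rewrite addr_ge0 ?(ip_ge0 ipP)//=.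
    have -> : H 0 - y *: 0 = 0 :> oddL2 R.
      have -> : H 0 = 0 :> oddL2 R.
        rewrite /ham (_ : mulop wP 0 = 0); last first.
          by apply: oddL2_inj => p; rewrite /= mulr0.
        by rewrite -(scale0r 0) (finite_rankZ ipP) !scale0r addr0.
      by rewrite scaler0 subr0.
    rewrite (ip0l ipP) addr0.
    have -> : H (a m) - y *: a m = (mulop wP (a m) - y *: a m) + finite_rank ip v psi (a m).
      by rewrite /ham addrAC.
    apply: le_trans (ip_sqrD_le ipP _ _) _.
    rewrite lerD2l ler_pM2l// mulrC finite_rank_le// => k.
    by rewrite /s (bigD1 k)//= lerDl sumr_ge0.
  + exact: cvg_cst.
  + by under eq_fun do rewrite mulrA; apply: cvg0_lincomb => //; exact: cvg0_sqr.
Qed.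

End EssentialSpectrum.

(** * Weyl sequences supported on shrinking boxes *)

Section WeylBoxes.
Context {R : realType}.
Local Notation mR := (measurableTypeR R).
Local Notation T2 := (mR * mR)%type.
Local Notation torus := (@torus R).
Local Notation leb2 := (@leb2 R).
Local Notation ip := (@rinner R).
Local Notation ipP := (@rinner_semi_inner R).

Definition box (a b c d : R) : set T2 := [set` `]a, b[] `*` [set` `]c, d[].

Lemma measurable_box a b c d : measurable (box a b c d).
Proof. by apply: measurableX; exact: measurable_itv. Qed.

Lemma boxP a b c d p : box a b c d p <-> (a < p.1 < b) /\ (c < p.2 < d).
Proof. by rewrite /box /= !in_itv /=. Qed.

Lemma box_opp a b c d p : box a b c d (- p) <-> box (- b) (- a) (- d) (- c) p.
Proof.
by rewrite !boxP /=; split=> -[/andP[h1 h2] /andP[h3 h4]];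
  split; apply/andP; split; lra.
Qed.

Lemma box_torus a b c d p : 0 <= a -> b <= pi -> 0 <= c -> d <= pi ->
  box a b c d p -> torus p /\ torus (- p).
Proof.
move=> a0 bpi c0 dpi /boxP[/andP[h1 h2] /andP[h3 h4]].
by rewrite /Defs.torus /= !in_itv /=; split; split; apply/andP; split; lra.
Qed.

Lemma measurable_indic_box a b c d : measurable_fun torus (\1_(box a b c d) : T2 -> R).
Proof. by apply: measurable_funTS; apply: measurable_indic; exact: measurable_box. Qed.

(* Odd, and constant on a box and on its mirror image: shrinking the box yields
   a singular Weyl sequence. *)
Definition box_wave (a b c d : R) (p : T2) : R :=
  \1_(box a b c d) p - \1_(box (- b) (- a) (- d) (- c)) p.

(** Even, so that multiplication by it preserves oddness; for [0 <= a] it fixes [box_wave] and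
    serves as a cutoff to its support. *)
Definition box_pair (a b c d : R) (p : T2) : R :=
  \1_(box a b c d) p + \1_(box (- b) (- a) (- d) (- c)) p.

Lemma indic_box_opp a b c d p :
  \1_(box a b c d) (- p) = \1_(box (- b) (- a) (- d) (- c)) p :> R.
Proof.
rewrite !indicE; congr (nat_of_bool _)%:R.
by apply/idP/idP; rewrite !inE => /box_opp.
Qed.

Lemma indic_box_opp2 a b c d p :
  \1_(box (- b) (- a) (- d) (- c)) (- p) = \1_(box a b c d) p :> R.
Proof. by rewrite indic_box_opp !opprK. Qed.

Lemma indic_box_disjoint a b c d p : 0 <= a ->
  \1_(box a b c d) p * \1_(box (- b) (- a) (- d) (- c)) p = 0 :> R.
Proof.
move=> a0; rewrite !indicE.
case: (boolP (p \in _)) => [/set_mem/boxP[/andP[h1 _] _]|_]; last by rewrite mul0r.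
case: (boolP (p \in _)) => [/set_mem/boxP[/andP[_ h2] _]|_]; last by rewrite mulr0.
lra.
Qed.

Lemma indic01 (B : set T2) p : \1_B p = 0 :> R \/ \1_B p = 1 :> R.
Proof. by rewrite indicE; case: (p \in B); [right|left]. Qed.

Lemma box_wave_odd a b c d : odd_square_integrable (box_wave a b c d).
Proof.
split.
  apply: (@square_integrable_bounded _ _ 1).
    by apply: measurable_funB; exact: measurable_indic_box.
  move=> p _; rewrite /box_wave.
  by have [->|->] := indic01 (box a b c d) p;
    have [->|->] := indic01 (box (- b) (- a) (- d) (- c)) p;
    rewrite ?subr0 ?subrr ?sub0r ?normrN ?normr0 ?normr1.
by apply: ae_torusW => p _; rewrite /box_wave indic_box_opp indic_box_opp2 opprB.
Qed.

Lemma box_pair_multiplier a b c d : multiplier (box_pair a b c d).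
Proof.
split.
- by apply: measurable_funD; exact: measurable_indic_box.
- exists 2 => p; rewrite /box_pair.
  have [->|->] := indic01 (box a b c d) p;
    have [->|->] := indic01 (box (- b) (- a) (- d) (- c)) p;
    rewrite ger0_norm; lra.
- by move=> p; rewrite /box_pair indic_box_opp indic_box_opp2 addrC.
Qed.

(** The square of the wave dominates the indicator of one box, whose integral is its area. *)
Lemma box_wave_norm a b c d : 0 <= a -> a < b -> b <= pi -> 0 <= c -> c < d -> d <= pi ->
  0 < ip (mk_oddL2 (box_wave_odd a b c d)) (mk_oddL2 (box_wave_odd a b c d)).
Proof.
move=> a0 ab bpi c0 cd dpi.
have pos : 0 < (b - a) * (d - c) by rewrite mulr_gt0// subr_gt0.
have I1 : leb2.-integrable torus (EFin \o (fun p => \1_(box a b c d) p ^+ 2)).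
  apply: integrable_sqr; apply: (@square_integrable_bounded _ _ 1).
    exact: measurable_indic_box.
  by move=> p _; have [->|->] := indic01 (box a b c d) p; rewrite ?normr0 ?normr1.
apply: (lt_le_trans pos).
have -> : (b - a) * (d - c) = \int[leb2]_(p in torus) (\1_(box a b c d) p ^+ 2).
  rewrite /Rintegral.
  transitivity (fine (\int[leb2]_(p in torus) (\1_(box a b c d) p)%:E)); last first.
    congr fine; apply: eq_integral => p _; congr EFin.
    by have [->|->] := indic01 (box a b c d) p; rewrite ?expr0n ?expr1n.
  rewrite integral_indic//; last exact: measurable_box.
  rewrite (_ : _ `&` _ = box a b c d).
    exact: esym (congr1 fine (leb2_box (ltW ab) (ltW cd))).
  by apply/seteqP; split=> p; [case|move=> h; split=> //; exact: (box_torus a0 bpi c0 dpi h).1].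
apply: le_Rintegral => //; first exact: rinner_integrable.
move=> p _ /=; rewrite /box_wave -expr2 sqrrB indic_box_disjoint// mul0rn subr0.
by rewrite lerDl sqr_ge0.
Qed.

Lemma box_pair_wave a b c d p : 0 <= a ->
  box_pair a b c d p * box_wave a b c d p = box_wave a b c d p.
Proof.
move=> a0; have := indic_box_disjoint b c d p a0.
rewrite /box_pair /box_wave.
have [->|->] := indic01 (box a b c d) p;
  have [->|->] := indic01 (box (- b) (- a) (- d) (- c)) p; lra.
Qed.

(** Dominated convergence: applied at [p] and at [- p], the hypothesis shows that [p] is eventually
    outside both boxes. The majorant [4 g^2] comes from the crude bound [box_pair <= 2]. *)
Lemma box_pair_shrinks (a b c d : nat -> R) (g : oddL2 R) :
  (forall p, exists M, forall m, (M <= m)%N -> ~ box (a m) (b m) (c m) (d m) p) ->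
  (fun m => ip (mulop (box_pair_multiplier (a m) (b m) (c m) (d m)) g)
               (mulop (box_pair_multiplier (a m) (b m) (c m) (d m)) g)) @ \oo --> (0 : R).
Proof.
move=> ev; pose G m := mulop (box_pair_multiplier (a m) (b m) (c m) (d m)) g.
have := @dominated_convergence _ _ R leb2 torus measurable_torus
  (fun m p => (G m p * G m p)%:E) (cst 0%E) (fun p => (4 * (g p * g p))%:E).
case.
- by move=> m; exact: measurable_int (rinner_integrable (G m) (G m)).
- exact: measurable_cst.
- apply: aeW => p _.
  have [M1 hM1] := ev p; have [M2 hM2] := ev (- p).
  apply: cvg_near_cst; exists (maxn M1 M2) => // m /=; rewrite geq_max => /andP[m1 m2].
  have -> : box_pair (a m) (b m) (c m) (d m) p = 0.
    rewrite /box_pair -indic_box_opp !indicE !memNset ?addr0//; [exact: hM2|exact: hM1].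
  by rewrite mul0r mul0r.
- exact: (integrableZl measurable_torus 4 (rinner_integrable g g)).
- apply: aeW => p m _ /=; rewrite lee_fin /box_pair.
  have h : 0 <= g p * g p by rewrite -expr2 sqr_ge0.
  have [->|->] := indic01 (box (a m) (b m) (c m) (d m)) p;
    have [->|->] := indic01 (box (- b m) (- a m) (- d m) (- c m)) p;
    rewrite ger0_norm; nra.
move=> _ _; rewrite integral0 => cv.
exact: (fine_cvg cv).
Qed.

Lemma mulop_close (w : T2 -> R) (wP : multiplier w) (y D : R) (f : oddL2 R) :
  (forall p, f p != 0 -> `|w p - y| <= D) ->
  ip (mulop wP f - y *: f) (mulop wP f - y *: f) <= D ^+ 2 * ip f f.
Proof.
move=> wy; rewrite -(ipZl ipP); apply: le_Rintegral => //.
- exact: rinner_integrable.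
- exact: rinner_integrable.
- move=> p _; rewrite oddL2Z oddL2D oddL2N oddL2Z /=.
  have -> : (w p * f p - y * f p) * (w p * f p - y * f p) =
     (w p - y) ^+ 2 * (f p * f p) by ring.
  rewrite -[leRHS]mulrA; have [->|/wy fp] := eqVneq (f p) 0; first by rewrite !mulr0.
  rewrite ler_wpM2r -?expr2 ?sqr_ge0//.
  rewrite -(real_normK (num_real (w p - y))) ler_sqr ?nnegrE//.
  exact: le_trans fp.
Qed.

(** Normalized waves are fixed by the cutoff, so their pairing with [g] is at most the norm of the
    cut-off [g], which tends to 0. The residual is at most the variation of [w] around [y] on the
    boxes. *)
Lemma weyl_boxes (w : T2 -> R) (wP : multiplier w) y (C : R) (a b c d : nat -> R) :
  (forall m, [/\ 0 <= a m, a m < b m & b m <= pi]) ->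
  (forall m, [/\ 0 <= c m, c m < d m & d m <= pi]) ->
  (forall m p, box (a m) (b m) (c m) (d m) p -> `|w p - y| <= C * m.+1%:R^-1) ->
  (forall p, exists M, forall m, (M <= m)%N -> ~ box (a m) (b m) (c m) (d m) p) ->
  exists u : nat -> oddL2 R, [/\ forall m, ip (u m) (u m) = 1,
    forall g, (fun m => ip (u m) g) @ \oo --> (0 : R) &
    (fun m => ip (mulop wP (u m) - y *: u m) (mulop wP (u m) - y *: u m)) @ \oo
      --> (0 : R)].
Proof.
move=> hab hcd wy ev; have we := multiplier_even wP.
pose s m := mk_oddL2 (box_wave_odd (a m) (b m) (c m) (d m)).
have s0 m : 0 < ip (s m) (s m).
  by have [? ? ?] := hab m; have [? ? ?] := hcd m; exact: box_wave_norm.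
pose t m := (Num.sqrt (ip (s m) (s m)))^-1.
pose u m := t m *: s m.
have u1 m : ip (u m) (u m) = 1.
  rewrite (ipZl ipP) (ipZr ipP) mulrA -invfM -expr2 sqr_sqrtr ?(ltW (s0 m))//.
  by rewrite mulVf// gt_eqF.
pose chi m := mulop (box_pair_multiplier (a m) (b m) (c m) (d m)).
have chiu m : chi m (u m) = u m.
  have [a0 _ _] := hab m.
  by apply: oddL2_inj => p; rewrite /= mulrCA box_pair_wave.
exists u; split => //.
- move=> g; pose q m := ip (chi m g) (chi m g).
  have q0 : (fun m => Num.sqrt (q m)) @ \oo --> (0 : R).
    by apply: cvg0_sqrt; exact: box_pair_shrinks.
  apply/norm_cvg0P.
  apply: (@squeeze_cvgr _ _ _ _ (cst 0) (fun m => Num.sqrt (q m))) => //.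
  + apply: nearW => m; rewrite normr_ge0/= -sqrtr_sqr ler_wsqrtr//.
    rewrite -[in leLHS]chiu.
    have -> : ip (chi m (u m)) g = ip (u m) (chi m g).
      by apply: eq_Rintegral => p _ /=; ring.
    by apply: le_trans (ip_cauchy_schwarz ipP _ _) _; rewrite u1 mul1r.
  + exact: cvg_cst.
(* The summand [0 * 0] gives the majorant the shape of [cvg0_lincomb]. *)
- apply: (@squeeze_cvgr _ _ _ _ (cst 0) (fun m => C ^+ 2 * (m.+1%:R^-1) ^+ 2 + 0 * 0)).
  + apply: nearW => m; rewrite (ip_ge0 ipP)/= mul0r addr0 -exprMn.
    rewrite -[leRHS]mulr1 -[X in _ * X](u1 m); apply: mulop_close => p.
    have [pB _|pB up] := pselect (box (a m) (b m) (c m) (d m) p); first exact: wy.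
    (* Outside the first box a point of the support lies in its mirror image, where evenness of [w]
       applies. *)
    rewrite -we; apply: wy; apply/box_opp.
    apply: contrapT => pB'; move/eqP: up; apply.
    by rewrite oddL2Z /= /box_wave !indicE !memNset// subrr mulr0.
  + exact: cvg_cst.
  + apply: cvg0_lincomb; first exact/cvg0_sqr/cvg_harmonic.
    exact: cvg_cst.
Qed.

End WeylBoxes.

(** * The two-particle Hamiltonian *)

Section Hamiltonian.
Context {R : realType}.
Local Notation mR := (measurableTypeR R).
Local Notation T2 := (mR * mR)%type.
Local Notation torus := (@torus R).
Local Notation leb2 := (@leb2 R).
Local Notation ip := (@rinner R).
Local Notation ipP := (@rinner_semi_inner R).

Implicit Types (lambda mu : R) (K : R * R).

(* The interaction is [sum_(k < 6) coupling k * <., form_factor k> form_factor k];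
   the values at [k > 5] are junk. *)
Definition form_factor (k : nat) (p : T2) : R :=
  match k with
  | 0 => sin p.1 | 1 => sin p.2
  | 2 => sin (2 * p.1) | 3 => sin (2 * p.2)
  | 4 => sin p.1 * cos p.2 | _ => sin p.2 * cos p.1
  end.

Definition coupling (lambda mu : R) (k : nat) : R :=
  if (k < 2)%N then lambda / (2 * pi) ^+ 2
  else if (k < 4)%N then mu / (2 * pi) ^+ 2 else mu / (2 * pi ^+ 2).

Lemma measurable_fst_torus : measurable_fun torus (fst : T2 -> R).
Proof. exact: measurable_funTS measurable_fst. Qed.

Lemma measurable_snd_torus : measurable_fun torus (snd : T2 -> R).
Proof. exact: measurable_funTS measurable_snd. Qed.

Lemma measurable_sin_comp (f : T2 -> R) : measurable_fun torus f ->
  measurable_fun torus (fun p => sin (f p)).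
Proof.
move=> mf; apply: measurableT_comp => //.
exact: continuous_measurable_fun (@continuous_sin R).
Qed.

Lemma measurable_cos_comp (f : T2 -> R) : measurable_fun torus f ->
  measurable_fun torus (fun p => cos (f p)).
Proof.
move=> mf; apply: measurableT_comp => //.
exact: continuous_measurable_fun (@continuous_cos R).
Qed.

Lemma form_factor_odd k : odd_square_integrable (form_factor k).
Proof.
have m1 := measurable_fst_torus; have m2 := measurable_snd_torus.
have prod1 (x y : R) : `|x| <= 1 -> `|y| <= 1 -> `|x * y| <= 1.
  by move=> hx hy; rewrite normrM -[leRHS]mulr1 ler_pM.
split.
  apply: (@square_integrable_bounded _ _ 1).
    case: k => [|[|[|[|[|k]]]]] /=.
    - exact: measurable_sin_comp.
    - exact: measurable_sin_comp.
    - by apply: measurable_sin_comp; exact: measurable_funM.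
    - by apply: measurable_sin_comp; exact: measurable_funM.
    - by apply: measurable_funM; [exact: measurable_sin_comp|exact: measurable_cos_comp].
    - by apply: measurable_funM; [exact: measurable_sin_comp|exact: measurable_cos_comp].
  by move=> p _; case: k => [|[|[|[|[|k]]]]] /=; rewrite ?sin_max//;
    apply: prod1; rewrite ?sin_max ?cos_max.
apply: ae_torusW => p _.
by case: k => [|[|[|[|[|k]]]]] /=; rewrite ?mulrN ?sinN ?cosN ?mulNr.
Qed.

Definition form_factor_vec (k : nat) : oddL2 R := mk_oddL2 (form_factor_odd k).

Lemma dispersionE (K p : R * R) : dispersion K p =
  2 * ((1 - cos (K.1 / 2) * cos p.1) + (1 - cos (K.2 / 2) * cos p.2)).
Proof. by rewrite /dispersion !big_ord_recl big_ord0 addr0. Qed.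

Lemma dispersion_multiplier (K : R * R) : multiplier (dispersion K : T2 -> R).
Proof.
split.
- rewrite (_ : (dispersion K : T2 -> R) = fun p =>
    2 * ((1 - cos (K.1 / 2) * cos p.1) + (1 - cos (K.2 / 2) * cos p.2))); last first.
    by apply/funext => p; exact: dispersionE.
  have m1 := measurable_cos_comp measurable_fst_torus.
  have m2 := measurable_cos_comp measurable_snd_torus.
  apply: measurable_funM => //; apply: measurable_funD.
  + by apply: measurable_funB => //; exact: measurable_funM.
  + by apply: measurable_funB => //; exact: measurable_funM.
- exists 8 => p; rewrite dispersionE.
  have b (x y : R) : -1 <= cos x * cos y <= 1.
    by rewrite -ler_norml normrM -[leRHS]mulr1 ler_pM// cos_max.
  have /andP[h1 h2] := b (K.1 / 2) p.1; have /andP[h3 h4] := b (K.2 / 2) p.2.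
  by rewrite ler_norml; apply/andP; split; lra.
- by move=> p; rewrite !dispersionE /= !cosN.
Qed.

Definition real_hamiltonian (lambda mu : R) (K : R * R) : oddL2 R -> oddL2 R :=
  ham ip (fun k : 'I_6 => coupling lambda mu k) (fun k => form_factor_vec k)
    (mulop (dispersion_multiplier K)).

Lemma cintegral_form_factor k (a b : oddL2 R) :
  cintegral (fun t => (form_factor k t)%:C%C * cplx a b t) =
  Complex (ip a (form_factor_vec k)) (ip b (form_factor_vec k)).
Proof.
by rewrite /cintegral; congr Complex; apply: eq_Rintegral => p _ /=; ring.
Qed.

Lemma real_hamiltonianE lambda mu K f s :
  real_hamiltonian lambda mu K f s = dispersion K s * f s +
    \sum_(k < 6) coupling lambda mu k * ip f (form_factor_vec k) * form_factor k s.
Proof. by rewrite /real_hamiltonian /ham oddL2D oddL2_sum. Qed.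

(** Links the integral operator to the abstract setting: all its coefficients are real, so it acts
    on each component. *)
Lemma hamiltonian_cplx lambda mu K (a b : oddL2 R) :
  hamiltonian lambda mu K (cplx a b) =
  cplx (real_hamiltonian lambda mu K a) (real_hamiltonian lambda mu K b).
Proof.
apply/funext => s; rewrite /hamiltonian /free_hamiltonian /interaction.
have I k := cintegral_form_factor k a b.
have := I 5%N; have := I 4%N; have := I 3%N; have := I 2%N; have := I 1%N; have := I 0%N.
rewrite /= => I0 I1 I2 I3 I4 I5.
rewrite !big_ord_recl !big_ord0 !big_mkcond !big_ord_recl !big_ord0 /=.
rewrite !big_mkcond !big_ord_recl !big_ord0 /tcoord /=.
rewrite I0 I1 I2 I3 I4 I5 /cplx !real_hamiltonianE.
rewrite !big_ord_recl !big_ord0 /coupling /=.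
simpc; congr Complex; ring.
Qed.


Lemma real_hamiltonian_gap lambda mu K (y del : R) : 0 < del ->
  (forall p, del <= `|dispersion K p - y|) -> ~ ess_spectrum (hamiltonian lambda mu K) y.
Proof.
by move=> del0 gap; apply: (not_ess_spectrum (hamiltonian_cplx lambda mu K) del0 gap).
Qed.

(** * Extrema of the dispersion relation and the essential spectrum *)

Definition dispersion_min (K : R * R) : R :=
  2 * ((1 - cos (K.1 / 2)) + (1 - cos (K.2 / 2))).

Definition dispersion_max (K : R * R) : R :=
  2 * ((1 + cos (K.1 / 2)) + (1 + cos (K.2 / 2))).

(** The choice of representatives enters here: it puts [K_i / 2] in [[-pi/2, pi/2]]. *)
Lemma cos_half_torus (K : R * R) : torus K ->
  (0 <= cos (K.1 / 2) <= 1) /\ (0 <= cos (K.2 / 2) <= 1).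
Proof.
rewrite /Defs.torus /= !in_itv /= => -[/andP[h1 h2] /andP[h3 h4]].
by split; rewrite cos_le1 andbT cos_ge0_pihalf//; apply/andP; split; lra.
Qed.

Lemma dispersion_min_le K p : torus K -> dispersion_min K <= dispersion K p.
Proof.
move=> /cos_half_torus[/andP[a0 _] /andP[b0 _]].
rewrite dispersionE /dispersion_min; have := cos_le1 p.1; have := cos_le1 p.2; nra.
Qed.

Lemma dispersion_max_ge K p : torus K -> dispersion K p <= dispersion_max K.
Proof.
move=> /cos_half_torus[/andP[a0 _] /andP[b0 _]].
rewrite dispersionE /dispersion_max; have := cos_geN1 p.1; have := cos_geN1 p.2; nra.
Qed.

Lemma dispersion0E p : dispersion (0, 0) p = 2 * ((1 - cos p.1) + (1 - cos p.2)) :> R.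
Proof. by rewrite dispersionE /= mul0r cos0 !mul1r. Qed.

Lemma torus0 : torus (0, 0).
Proof. by have := @pi_gt0 R; rewrite /Defs.torus /= in_itv /=; split; apply/andP; split; lra. Qed.

Lemma dispersion_min0 : dispersion_min (0, 0) = 0.
Proof. by rewrite /dispersion_min /= mul0r cos0 subrr addr0 mulr0. Qed.

Lemma dispersion_max0 : dispersion_max (0, 0) = 8.
Proof. by rewrite /dispersion_max /= mul0r cos0; ring. Qed.

Lemma dispersion_min_mono K p : torus K ->
  dispersion K p - dispersion_min K <= dispersion (0, 0) p - dispersion_min (0, 0).
Proof.
move=> /cos_half_torus[/andP[_ a1] /andP[_ b1]].
rewrite dispersion_min0 dispersion0E dispersionE /dispersion_min.
have := cos_le1 p.1; have := cos_le1 p.2; nra.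
Qed.

(** The left-hand side is [2 sum_i cos (K_i / 2) (1 + cos p_i)], and the cosines of [K_i / 2] are at
    most 1. *)
Lemma dispersion_max_mono K p : torus K ->
  dispersion_max K - dispersion K p <= dispersion_max (0, 0) - dispersion (0, 0) p.
Proof.
move=> /cos_half_torus[/andP[_ a1] /andP[_ b1]].
rewrite dispersion_max0 dispersion0E dispersionE /dispersion_max.
have := cos_geN1 p.1; have := cos_geN1 p.2; nra.
Qed.

Lemma ess_spectrum_ge lambda mu K (y : R) : torus K ->
  ess_spectrum (hamiltonian lambda mu K) y -> dispersion_min K <= y.
Proof.
move=> tK ess; rewrite leNgt; apply/negP => lt.
apply: (@real_hamiltonian_gap lambda mu K y (dispersion_min K - y)) ess.
  by rewrite subr_gt0.
move=> p; rewrite ger0_norm ?lerD2r ?dispersion_min_le// subr_ge0.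
exact: le_trans (ltW lt) (dispersion_min_le p tK).
Qed.

Lemma ess_spectrum_le lambda mu K (y : R) : torus K ->
  ess_spectrum (hamiltonian lambda mu K) y -> y <= dispersion_max K.
Proof.
move=> tK ess; rewrite leNgt; apply/negP => lt.
apply: (@real_hamiltonian_gap lambda mu K y (y - dispersion_max K)) ess.
  by rewrite subr_gt0.
move=> p; rewrite distrC ger0_norm ?lerD2l ?lerN2 ?dispersion_max_ge// subr_ge0.
exact: le_trans (dispersion_max_ge p tK) (ltW lt).
Qed.

(** Widths for the boxes: the bound on [1 - cos x] keeps the dispersion near its extremum, and the
    bound on [del m] makes the boxes fit into [[0, pi]] and leave every point. *)
Lemma cos_near0 : exists del : nat -> R, forall m,
  [/\ 0 < del m, del m <= m.+1%:R^-1 & forall x, 0 < x < del m -> 1 - cos x <= m.+1%:R^-1].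
Proof.
suff /choice[del h] : forall m : nat, exists d : R, [/\ 0 < d, d <= m.+1%:R^-1 &
    forall x, 0 < x < d -> 1 - cos x <= m.+1%:R^-1] by exists del.
move=> m; have m0 : 0 < m.+1%:R^-1 :> R by rewrite invr_gt0.
have := @continuous_cos R 0; rewrite /continuous_at cos0.
move=> /cvgrPdist_lt/(_ _ m0)/nbhs_ballP[d d0 hd].
exists (Num.min d m.+1%:R^-1); split.
- by rewrite lt_min d0 m0.
- by rewrite ge_min lexx orbT.
- move=> x /andP[x0]; rewrite lt_min => /andP[xd _].
  have /hd/ltW : ball (0 : R) d x by rewrite /ball /= sub0r normrN gtr0_norm.
  by rewrite ger0_norm// subr_ge0 cos_le1.
Qed.

Lemma pi_ge1 : 1 <= pi :> R.
Proof. by have := @pi_ge2 R; lra. Qed.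

(** Boxes []0, del m[^2] shrink to the minimum point. The constant 4 is the factor 2 of the
    dispersion times two coordinates. *)
Lemma dispersion_min0_ess lambda mu :
  ess_spectrum (hamiltonian lambda mu (0, 0)) (dispersion_min (0, 0)).
Proof.
have [del hdel] := cos_near0.
have del_le_pi m : del m <= pi.
  have [_ h _] := hdel m; apply: le_trans h (le_trans _ pi_ge1).
  by rewrite invf_le1// ler1n.
have [//|//|m p|p|u [u1 u2 u3]] := @weyl_boxes R _ (dispersion_multiplier (0, 0))
  (dispersion_min (0, 0)) 4 (fun=> 0) del (fun=> 0) del.
- by move=> m; have [? _ _] := hdel m; split.
- by move=> m; have [? _ _] := hdel m; split.
- move=> /boxP[h1 h2]; have [_ _ hc] := hdel m.
  rewrite dispersion_min0 subr0 dispersion0E; have := hc _ h1; have := hc _ h2.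
  have := cos_le1 p.1; have := cos_le1 p.2.
  by move: (m.+1%:R^-1) => z ? ? ? ?; rewrite ger0_norm; lra.
- have [p0|p0] := ltP 0 p.1; last first.
    by exists 0%N => m _ /boxP[/andP[+ _] _]; rewrite ltNge p0.
  have [M hM] := invn_eventually_le p0; exists M => m /hM mp /boxP[/andP[_ +] _].
  by have [_ h _] := hdel m; apply/negP; rewrite -leNgt (le_trans h).
exact: (weyl_ess_spectrum (hamiltonian_cplx lambda mu (0, 0)) u1 u2 u3).
Qed.

(** The boxes now shrink to the corner [(pi, pi)], and [cos (pi - x) = - cos x] reduces the estimate
    to the one near 0. *)
Lemma dispersion_max0_ess lambda mu :
  ess_spectrum (hamiltonian lambda mu (0, 0)) (dispersion_max (0, 0)).
Proof.
have [del hdel] := cos_near0.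
have del_le_pi m : del m <= pi.
  have [_ h _] := hdel m; apply: le_trans h (le_trans _ pi_ge1).
  by rewrite invf_le1// ler1n.
have [//|//|m p|p|u [u1 u2 u3]] := @weyl_boxes R _ (dispersion_multiplier (0, 0))
  (dispersion_max (0, 0)) 4 (fun m => pi - del m) (fun=> pi) (fun m => pi - del m) (fun=> pi).
- by move=> m; have [? _ _] := hdel m; have := del_le_pi m; split; lra.
- by move=> m; have [? _ _] := hdel m; have := del_le_pi m; split; lra.
- move=> /boxP[h1 h2]; have [_ _ hc] := hdel m.
  have cospiB x : cos (pi - x) = - cos x :> R by rewrite addrC cosDpi cosN.
  have near x : pi - del m < x < pi -> 1 + cos x <= m.+1%:R^-1.
    move=> /andP[x1 x2]; rewrite -[cos x]opprK -cospiB; apply: hc.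
    by apply/andP; split; lra.
  rewrite dispersion_max0 dispersion0E; have := near _ h1; have := near _ h2.
  have := cos_geN1 p.1; have := cos_geN1 p.2.
  by move: (m.+1%:R^-1) => z ? ? ? ?; rewrite ler0_norm; lra.
- have [p0|p0] := ltP p.1 pi; last first.
    by exists 0%N => m _ /boxP[/andP[_ +] _]; rewrite ltNge p0.
  have p1 : 0 < pi - p.1 by rewrite subr_gt0.
  have [M hM] := invn_eventually_le p1; exists M => m /hM mp /boxP[/andP[+ _] _].
  have [_ h _] := hdel m; apply/negP; rewrite -leNgt lerBrDr addrC -lerBrDr.
  exact: le_trans h mp.
exact: (weyl_ess_spectrum (hamiltonian_cplx lambda mu (0, 0)) u1 u2 u3).
Qed.

(** * Comparison of the Hamiltonians at [K] and at 0 *)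

Lemma semibounded_dispersion K : torus K ->
  semibounded ip (mulop (dispersion_multiplier K)) (dispersion_min K).
Proof. by move=> tK; apply: semibounded_mulop => p; exact: dispersion_min_le. Qed.

Definition opp_dispersion_multiplier K := multiplierN (dispersion_multiplier K).

Lemma semibounded_opp_dispersion K : torus K ->
  semibounded ip (mulop (opp_dispersion_multiplier K)) (- dispersion_max K).
Proof.
by move=> tK; apply: semibounded_mulop => p; rewrite lerN2; exact: dispersion_max_ge.
Qed.

Lemma rinner_mulop_mono w0 w1 (w0P : multiplier w0) (w1P : multiplier w1) a0 a1 :
  (forall p, w1 p - a1 <= w0 p - a0) ->
  forall f, ip (mulop w1P f) f - a1 * ip f f <= ip (mulop w0P f) f - a0 * ip f f.
Proof.
move=> w01 f; rewrite -!(ipZl ipP) -!(ipBl ipP); apply: le_Rintegral => //.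
- exact: rinner_integrable.
- exact: rinner_integrable.
- move=> p _; rewrite !oddL2D !oddL2N !oddL2Z /= -!mulrBl -!mulrA -expr2.
  by rewrite ler_wpM2r ?sqr_ge0.
Qed.

(** The negative of the Hamiltonian is written again as a [ham], so that the results for eigenvalues
    below apply to those above. *)
Definition opp_real_hamiltonian (lambda mu : R) (K : R * R) : oddL2 R -> oddL2 R :=
  ham ip (fun k : 'I_6 => - coupling lambda mu k) (fun k => form_factor_vec k)
    (mulop (opp_dispersion_multiplier K)).

Lemma opp_real_hamiltonianE lambda mu K f :
  opp_real_hamiltonian lambda mu K f = - real_hamiltonian lambda mu K f.
Proof.
rewrite /opp_real_hamiltonian /real_hamiltonian /ham opprD; congr (_ + _).
  by apply: oddL2_inj => p; rewrite oddL2N /= mulNr.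
by rewrite /finite_rank -sumrN; apply: eq_bigr => k _; rewrite mulNr scaleNr.
Qed.

Lemma real_hamiltonianD lambda mu K f g : torus K ->
  real_hamiltonian lambda mu K (f + g) =
  real_hamiltonian lambda mu K f + real_hamiltonian lambda mu K g.
Proof. by move=> tK; rewrite /real_hamiltonian (hamD ipP _ _ (semibounded_dispersion tK)). Qed.

Lemma real_hamiltonianZ lambda mu K c f : torus K ->
  real_hamiltonian lambda mu K (c *: f) = c *: real_hamiltonian lambda mu K f.
Proof. by move=> tK; rewrite /real_hamiltonian (hamZ ipP _ _ (semibounded_dispersion tK)). Qed.

Lemma real_hamiltonian_sym lambda mu K f g : torus K ->
  ip (real_hamiltonian lambda mu K f) g = ip f (real_hamiltonian lambda mu K g).
Proof. by move=> tK; rewrite /real_hamiltonian (ham_sym ipP _ _ (semibounded_dispersion tK)). Qed.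

Lemma real_hamiltonian_below lambda mu K n : torus K ->
  has_eigensystem ip (real_hamiltonian lambda mu (0, 0))
    [set x | x < dispersion_min (0, 0)] n ->
  has_eigensystem ip (real_hamiltonian lambda mu K) [set x | x < dispersion_min K] n.
Proof.
move=> tK; apply: (@has_eigensystem_le _ _ _ ipP _ _ _ _ _ _ _ _ (semibounded_dispersion torus0)
  (semibounded_dispersion tK)).
by apply: rinner_mulop_mono => p; exact: dispersion_min_mono.
Qed.

Lemma real_hamiltonian_above lambda mu K n : torus K ->
  has_eigensystem ip (real_hamiltonian lambda mu (0, 0))
    [set x | dispersion_max (0, 0) < x] n ->
  has_eigensystem ip (real_hamiltonian lambda mu K) [set x | dispersion_max K < x] n.
Proof.
move=> tK h0.
have h1 : has_eigensystem ip (opp_real_hamiltonian lambda mu (0, 0))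
    [set x | x < - dispersion_max (0, 0)] n.
  apply: (has_eigensystem_opp ipP _ _ h0) => [f|x /=]; first exact: opp_real_hamiltonianE.
  by rewrite ltrN2.
apply: (@has_eigensystem_opp _ _ _ ipP (opp_real_hamiltonian lambda mu K) _
  [set x | x < - dispersion_max K]).
- by move=> f; rewrite opp_real_hamiltonianE opprK.
- by move=> x /=; rewrite ltrNr.
apply: (@has_eigensystem_le _ _ _ ipP _ _ _ _ _ _ _ _ (semibounded_opp_dispersion torus0)
  (semibounded_opp_dispersion tK) _ h1).
apply: rinner_mulop_mono => p; rewrite !opprK addrC [leRHS]addrC.
exact: dispersion_max_mono.
Qed.

End Hamiltonian.

Theorem theorem3p1 (R : realType) (lambda mu : R) (n : nat) :
  (num_eigen_below (hamiltonian lambda mu (0%R, 0%R)) = (n%:R)%:E ->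
     forall K : R * R, torus K ->
       ((n%:R)%:E <= num_eigen_below (hamiltonian lambda mu K))%E)
  /\
  (num_eigen_above (hamiltonian lambda mu (0%R, 0%R)) = (n%:R)%:E ->
     forall K : R * R, torus K ->
       ((n%:R)%:E <= num_eigen_above (hamiltonian lambda mu K))%E).
Proof.
have t0 := @torus0 R.
split=> numE K tK.
- apply: (eigensystem_le_num (hamiltonian_cplx lambda mu K)
    (fun c f => real_hamiltonianZ lambda mu c f tK)).
  (* At [K] it suffices that the essential spectrum lies above [dispersion_min K]. *)
  apply: has_eigensystemS (real_hamiltonian_below tK _).
    by move=> x /= xlt y /(ess_spectrum_ge tK); exact: lt_le_trans.
  have := num_eq_has_eigensystem (hamiltonian_cplx lambda mu (0, 0))
    (fun f g => real_hamiltonianD lambda mu f g t0)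
    (fun c f => real_hamiltonianZ lambda mu c f t0)
    (fun f g => real_hamiltonian_sym lambda mu f g t0) numE.
  (* At 0 the edge itself must belong to the essential spectrum, so that the eigenvalues counted lie
     strictly below it. *)
  apply: has_eigensystemS => x /=; apply; exact: dispersion_min0_ess.
- apply: (eigensystem_le_num (hamiltonian_cplx lambda mu K)
    (fun c f => real_hamiltonianZ lambda mu c f tK)).
  apply: has_eigensystemS (real_hamiltonian_above tK _).
    by move=> x /= xlt y /(ess_spectrum_le tK) yle; exact: le_lt_trans xlt.
  have := num_eq_has_eigensystem (hamiltonian_cplx lambda mu (0, 0))
    (fun f g => real_hamiltonianD lambda mu f g t0)
    (fun c f => real_hamiltonianZ lambda mu c f t0)
    (fun f g => real_hamiltonian_sym lambda mu f g t0) numE.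
  apply: has_eigensystemS => x /=; apply; exact: dispersion_max0_ess.
Qed.
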